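(* Let $d\ge1$, $\alpha>0$, $\delta>0$ with $0<\alpha\delta\le d$, and let $\{\omega_n\}_{n\in\mathbb{Z}^d}$ be i.i.d. real random variables whose common distribution $\mu$ is absolutely continuous with density $$\frac{d\mu}{dx}(x)=\begin{cases}0 & \text{if } |x|<1,\\ \dfrac{\delta}{2}\dfrac{1}{|x|^{1+\delta}} & \text{if } |x|>1.\end{cases}$$ Let $H^\omega_L$ be the restriction to the cube $\Lambda_L$ of $H^\omega=\Delta+V^\omega$, where $\Delta$ is the discrete Laplacian on $\ell^2(\mathbb{Z}^d)$ and $V^\omega$ is multiplication by $\omega_n(1+|n|)^{-\alpha}$. Let $E^{\max}_L(\omega)=\max\sigma(H^\omega_L)$ and $E^{\min}_L(\omega)=\min\sigma(H^\omega_L)$. Put $$\Gamma_L=\begin{cases}(2L+1)^{\frac{d-\alpha\delta}{\delta}} & \text{if } 0<\alpha\delta<d,\\ \big(\ln(2L+1)\big)^{\frac1\delta} & \text{if } \alpha\delta=d,\end{cases}\qquad b=\lim_{L\to\infty}\frac{1}{\Gamma_L^\delta}\sum_{n\in\Lambda_L}\frac{1}{(1+|n|)^{\alpha\delta}}>0.$$ Then the asymptotic distribution of the highest eigenvalue is given by $$\lim_{L\to\infty}\mathbb{P}\left(\omega:\frac{E^{\max}_L(\omega)}{\Gamma_L}\le x\right)=\begin{cases}e^{-\frac{b}{2x^\delta}} & \text{if } x>0,\\ 0 & \text{if } x\le 0,\end{cases}$$ and the asymptotic distribution of the lowest eigenvalue is given by $$\lim_{L\to\infty}\mathbb{P}\left(\omega:\frac{E^{\min}_L(\omega)}{\Gamma_L}\le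 x\right)=\begin{cases}1 & \text{if } x\ge 0,\\ 1-e^{-\frac{b}{2|x|^\delta}} & \text{if } x<0.\end{cases}$$
   Context: Probability space: $\Omega=\mathbb{R}^{\mathbb{Z}^d}$ with its product Borel $\sigma$-algebra and $\mathbb{P}=\bigotimes_{n\in\mathbb{Z}^d}\mu$; $\omega=(\omega_n)_{n\in\mathbb{Z}^d}\in\Omega$. Operators on $\ell^2(\mathbb{Z}^d)$: $(\Delta u)(n)=\sum_{|k-n|=1}u(k)$ (sum over the $2d$ nearest neighbours $k$ of $n$, no diagonal term), and $(V^\omega u)(n)=\frac{\omega_n}{(1+|n|)^\alpha}u(n)$. Here $|\cdot|$ is a fixed norm, either the Euclidean or the $\ell^1$ norm on $\mathbb{Z}^d$, so that $|k-n|=1$ means nearest neighbours; the same norm is used in the definition of $b$. Finite volume: $\Lambda_L=\{n=(n_1,\dots,n_d)\in\mathbb{Z}^d: |n_i|\le L,\ i=1,\dots,d\}$ for $L\in\mathbb{N}$, and $\chi_L$ is the orthogonal projection onto $\ell^2(\Lambda_L)$. Put $\Delta_L=\chi_L\Delta\chi_L$, $V^\omega_L=\chi_LV^\omega\chi_L$, $H^\omega_L=\Delta_L+V^\omega_L$, regarded as matrices of size $(2L+1)^d$ acting on $\ell^2(\Lambda_L)$; $\sigma(\cdot)$ denotes the spectrum. *)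

(* Defs.v *)
From HB Require Import structures.
From mathcomp Require Import all_boot all_order all_algebra.
From mathcomp Require Import finmap complex.
From mathcomp Require Import all_classical all_reals all_analysis.

Set Implicit Arguments.
Unset Strict Implicit.
Unset Printing Implicit Defensive.

Import Order.TTheory GRing.Theory Num.Theory.
Import numFieldNormedType.Exports.

Local Open Scope classical_set_scope.
Local Open Scope ring_scope.

Notation lattice d := {ffun 'I_d -> int}.

Section Lattice.
Variables (R : realType) (d : nat).
Implicit Types (n k : lattice d) (u : lattice d -> R).

Definition l1_norm n : R := \sum_(i < d) `|(n i)%:~R|.

Definition l2_norm n : R := Num.sqrt (\sum_(i < d) (n i)%:~R ^+ 2).

Definition cube (L : nat) : set (lattice d) :=
  [set n | forall i, `|n i| <= L%:Z].

Lemma finite_cube L : finite_set (cube L).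
Proof.
pose f (g : {ffun 'I_d -> 'I_(2 * L).+1}) : lattice d :=
  [ffun i => (g i)%:Z - L%:Z].
apply: (@sub_finite_set _ _ (f @` setT)); last exact/finite_image/finite_finset.
move=> n nL; exists [ffun i => inord `|(n i + L%:Z)%R|%N] => //.
apply/ffunP => i; rewrite !ffunE.
have := nL i; rewrite ler_norml => /andP[h1 h2].
have h3 : 0 <= n i + L%:Z by rewrite -lerBlDr sub0r.
rewrite inordK; first by rewrite gez0_abs// addrK.
rewrite ltnS -lez_nat gez0_abs// mul2n -addnn PoszD lerD2r//.
Qed.

Lemma coord_le_norm (nrm : lattice d -> R) n i :
  nrm = l1_norm \/ nrm = l2_norm -> `|(n i)%:~R| <= nrm n.
Proof.
case=> ->.
  by rewrite /l1_norm (bigD1 i)//= lerDl sumr_ge0.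
rewrite /l2_norm -sqrtr_sqr ler_wsqrtr//.
rewrite (bigD1 i)//=.
by rewrite lerDl sumr_ge0// => j _; rewrite sqr_ge0.
Qed.

Lemma normNE (nrm : lattice d -> R) n :
  nrm = l1_norm \/ nrm = l2_norm -> nrm (- n) = nrm n.
Proof.
case=> ->; [|congr Num.sqrt]; apply: eq_bigr => i _; rewrite ffunE.
  by rewrite rmorphN normrN.
by rewrite rmorphN sqrrN.
Qed.

(* The finite-support sum defining the Laplacian below is thus the genuine sum
   over the neighbours of n. *)
Lemma finite_neighbours (nrm : lattice d -> R) n :
  nrm = l1_norm \/ nrm = l2_norm -> finite_set [set k | nrm (k - n) = 1].
Proof.
move=> nrmE; apply: (@sub_finite_set _ _ ((fun k => k + n) @` cube 1)).
  move=> k /= kn; exists (k - n); last by rewrite subrK.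
  by move=> i; rewrite -(ler_int R) intr_norm (le_trans (coord_le_norm _ i nrmE))// kn.
exact/finite_image/finite_cube.
Qed.

Definition laplacian (nrm : lattice d -> R) u : lattice d -> R :=
  fun n => \sum_(k \in [set k | nrm (k - n) = 1]) u k.

Definition potential (nrm : lattice d -> R) (alpha : R) (w : lattice d -> R) u
    : lattice d -> R :=
  fun n => w n / (1 + nrm n) `^ alpha * u n.

Definition basis_vector k : lattice d -> R := fun n => (n == k)%:R.

(* Matrix of chi_J T chi_J in the canonical basis of l^2(J). *)
Definition compression (J : {fset lattice d})
    (T : (lattice d -> R) -> (lattice d -> R)) : 'M[R]_#|{: J}| :=
  \matrix_(i, j) T (basis_vector (val (enum_val j))) (val (enum_val i)).

Definition box_hamiltonian (nrm : lattice d -> R) (alpha : R)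
    (w : lattice d -> R) (L : nat) : 'M[R]_#|{: fset_set (cube L)}| :=
  compression (fset_set (cube L)) (laplacian nrm) +
  compression (fset_set (cube L)) (potential nrm alpha w).

Lemma box_hamiltonian_sym (nrm : lattice d -> R) alpha w L :
  nrm = l1_norm \/ nrm = l2_norm ->
  (box_hamiltonian nrm alpha w L)^T = box_hamiltonian nrm alpha w L.
Proof.
move=> nrmE; apply/matrixP => i j; rewrite !mxE; congr (_ + _); last first.
  rewrite /potential /basis_vector eq_sym.
  by case: eqP => [->//|_]; rewrite !mulr0.
have E m k : laplacian nrm (basis_vector k) m = (nrm (k - m) == 1)%:R.
  rewrite /laplacian; case: eqP => [km|km].
    rewrite (fsbigD1 k)//=; last exact: finite_neighbours.
    rewrite /basis_vector eqxx fsbig1 ?addr0// => h [_ /eqP/negPf hk].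
    by rewrite hk.
  rewrite fsbig1// => h hm; rewrite /basis_vector; case: eqP => // hk.
  by rewrite hk in hm.
by rewrite !E -opprB normNE.
Qed.

Lemma box_size_gt0 L : (0 < #|{: fset_set (cube L)}|)%N.
Proof.
have x0 : 0 \in fset_set (cube L).
  rewrite in_fset_set ?inE//=; last exact: finite_cube.
  by move=> i; rewrite ffunE normr0.
by apply/card_gt0P; exists (FSetSub x0).
Qed.

End Lattice.

Section Spectrum.
Variables (R : realType) (N : nat).
Implicit Types A : 'M[R]_N.

Definition spectrum A : set R := [set x | eigenvalue A x].

Lemma spectrum_finite A : finite_set (spectrum A).
Proof.
have [rs Ers] := closed_field_poly_normal (map_poly (real_complex R) (char_poly A)).
apply: (@sub_finite_set _ _ ((@complex.Re R) @` [set` rs])); last exact/finite_image/finite_seq.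
move=> x; rewrite /spectrum /= eigenvalue_root_char => rx.
exists (x%:C)%C => //=.
have : root (map_poly (real_complex R) (char_poly A)) (x%:C)%C.
  by rewrite fmorph_root.
rewrite {1}Ers rootZ ?root_prod_XsubC//.
by rewrite lead_coef_eq0 map_poly_eq0 monic_neq0// char_poly_monic.
Qed.

Lemma spectrum_nonempty A : (0 < N)%N -> A^T = A -> spectrum A !=set0.
Proof.
move=> N0 AT; have [z /eigenvalueP[v vA v0]] :=
  eigenvalue_closed (map_mx (real_complex R) A) N0.
pose w := map_mx (@conjc R) v.
have wA : w *m map_mx (real_complex R) A = conjc z *: w.
  rewrite -map_mxZ -vA map_mxM; congr (_ *m _).
  by apply/matrixP => i j; rewrite !mxE/= oppr0.
have E : z *: (v *m w^T) = conjc z *: (v *m w^T).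
  rewrite scalemxAl -vA -mulmxA scalemxAr -linearZ/= -wA trmx_mul.
  by congr (_ *m (_ *m _)); apply/matrixP => i j; rewrite !mxE -{1}AT mxE.
have vw : (v *m w^T) 0 0 != 0.
  rewrite mxE psumr_neq0; last first.
    by move=> i _; rewrite !mxE -sqr_normc exprn_ge0.
  have [i vi] : exists i, v 0 i != 0.
    by apply/existsP; move: v0; apply: contraNT; rewrite negb_exists => /forallP v0;
      apply/eqP/rowP => i; rewrite mxE; apply/eqP; have := v0 i; rewrite negbK.
  apply/hasP; exists i; first exact: mem_index_enum.
  by rewrite !mxE -sqr_normc exprn_gt0// normr_gt0.
have zr : (complex.Re z)%:C%C = z.
  move/matrixP/(_ 0 0): E; rewrite [LHS]mxE [RHS]mxE => /(mulIf vw).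
  case: z {vA wA} => x y [] /= /eqP; rewrite -addr_eq0 -mulr2n mulrn_eq0 /= => /eqP ->.
  by [].
exists (complex.Re z); rewrite /spectrum /= -(eigenvalue_map (real_complex R)) /= zr.
by apply/eigenvalueP; exists v.
Qed.

(* Genuine maximum and minimum on symmetric matrices of positive size: see
   max_spectrumP and min_spectrumP. *)
Definition max_spectrum A : R := sup (spectrum A).

Definition min_spectrum A : R := inf (spectrum A).

Lemma max_spectrumP A : (0 < N)%N -> A^T = A ->
  spectrum A (max_spectrum A) /\ ubound (spectrum A) (max_spectrum A).
Proof.
move=> N0 AT; have ne := spectrum_nonempty N0 AT.
have /finite_seqP[s Es] := spectrum_finite A.
rewrite /max_spectrum Es in ne *.
have [m ms mub] : exists2 m, m \in s & {in s, forall x, x <= m}.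
  elim: s {Es} ne => [[x]//|y [|z s] IH _].
    by exists y; rewrite ?mem_head// => x; rewrite inE => /eqP ->.
  have [|m ms mub] := IH; first by exists z => /=; exact: mem_head.
  exists (Num.max m y).
    by case: leP => _; rewrite in_cons ?ms ?orbT ?eqxx.
  by move=> x; rewrite in_cons le_max => /predU1P[->|/mub ->]//; rewrite lexx orbT.
suff -> : sup [set` s] = m by split=> // x; exact: mub.
apply/eqP; rewrite eq_le; apply/andP; split; first by apply: ge_sup => // x; exact: mub.
by apply: ub_le_sup => //; exists m => x; exact: mub.
Qed.

Lemma min_spectrumP A : (0 < N)%N -> A^T = A ->
  spectrum A (min_spectrum A) /\ lbound (spectrum A) (min_spectrum A).
Proof.
move=> N0 AT; have ne := spectrum_nonempty N0 AT.
have /finite_seqP[s Es] := spectrum_finite A.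
rewrite /min_spectrum Es in ne *.
have [m ms mlb] : exists2 m, m \in s & {in s, forall x, m <= x}.
  elim: s {Es} ne => [[x]//|y [|z s] IH _].
    by exists y; rewrite ?mem_head// => x; rewrite inE => /eqP ->.
  have [|m ms mlb] := IH; first by exists z => /=; exact: mem_head.
  exists (Num.min m y).
    by case: leP => _; rewrite in_cons ?ms ?orbT ?eqxx.
  by move=> x; rewrite in_cons ge_min => /predU1P[->|/mlb ->]//; rewrite lexx orbT.
suff -> : inf [set` s] = m by split=> // x; exact: mlb.
apply/eqP; rewrite eq_le; apply/andP; split; last by apply: lb_le_inf => // x; exact: mlb.
by apply: ge_inf => //; exists m => x; exact: mlb.
Qed.

End Spectrum.

Section Probability.
Context {disp : measure_display} {T : measurableType disp} {R : realType}.
Variable P : probability T R.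

Definition mutually_independent (I : choiceType) (X : I -> {RV P >-> R}) :=
  forall (J : {fset I}) (A : I -> set R), (forall i, measurable (A i)) ->
    P (\bigcap_(i in [set` J]) X i @^-1` A i) =
    (\prod_(i <- J) P (X i @^-1` A i))%E.

Definition has_density (X : {RV P >-> R}) (f : R -> R) :=
  forall A : set R, measurable A ->
    distribution P X A = (\int[lebesgue_measure]_(x in A) (f x)%:E)%E.

End Probability.

Definition pareto_density (R : realType) (delta : R) (x : R) : R :=
  if 1 < `|x| then delta / 2 / `|x| `^ (1 + delta) else 0.

Definition Gamma (R : realType) (d : nat) (alpha delta : R) (L : nat) : R :=
  if alpha * delta < d%:R
  then (2 * L + 1)%:R `^ ((d%:R - alpha * delta) / delta)
  else ln (2 * L + 1)%:R `^ delta^-1.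

Definition normalized_weight_sum (R : realType) (d : nat)
    (nrm : lattice d -> R) (alpha delta : R) (L : nat) : R :=
  (Gamma d alpha delta L `^ delta)^-1 *
  \sum_(n \in cube L) ((1 + nrm n) `^ (alpha * delta))^-1.

(* Main.v *)
(* Let M be the maximum of the diagonal entries omega_n / (1+|n|)^alpha. The
   discrete Laplacian has zero diagonal and uniformly bounded row sums, so
   M <= Emax <= M + C: the lower bound is the Rayleigh principle, the upper one
   Gershgorin's. As Gamma_L tends to infinity, the limit law of Emax / Gamma_L is
   that of M / Gamma_L, whose distribution function is the product of the factors
   1 - t^(-delta) (1+|n|)^(-alpha delta) / 2, asymptotically
   exp (- t^(-delta) W_L / 2) with W_L the sum of (1+|n|)^(-alpha delta) over the
   cube. The same argument for -H gives Emin.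

   The limit b is obtained without integrals. Writing the points of a cube of side
   (2L+1)(2M+1) as (2L+1)q + r, with q and r in the cubes of sides 2M+1 and 2L+1,
   gives W_K = W_L + (2L+1)^(d-s) (W_M - 1) up to an error that involves only the
   sum of (1+|q|)^(-s-1), where s = alpha delta. For s < d the normalized sums at
   L and M are both close to the one at K, hence form a Cauchy sequence; for s = d
   the sums W are quasi-additive along K, hence asymptotically linear in the
   logarithm of the side. *)

Require Import Defs.
From HB Require Import structures.
From mathcomp Require Import all_boot all_order all_algebra.
From mathcomp Require Import finmap complex.
From mathcomp Require Import all_classical all_reals all_analysis.
From mathcomp Require Import ring lra zify.

Set Implicit Arguments.
Unset Strict Implicit.
Unset Printing Implicit Defensive.

Import Order.TTheory GRing.Theory Num.Theory.
Import numFieldNormedType.Exports.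

Local Open Scope classical_set_scope.
Local Open Scope ring_scope.

(** * Spectrum of a symmetric matrix *)

Lemma cvg_sumr (R : realFieldType) (I T : Type) (F : set_system T) {FF : Filter F}
    (r : seq I) (f : I -> T -> R) (a : I -> R) :
  (forall i, f i x @[x --> F] --> a i) ->
  \sum_(i <- r) f i x @[x --> F] --> \sum_(i <- r) a i.
Proof. by move=> fa; apply: cvg_big => // x; exact: add_continuous. Qed.

(** Diagonalise [A] by a unitary [P]: the rows of [P] are eigenvectors and [w] holds the coordinates
    of [v] in that basis, where both forms are diagonal. *)
Lemma hermitian_quadratic_form (C : numClosedFieldType) (N : nat) (A : 'M[C]_N)
    (v : 'rV[C]_N) : A \is hermsymmx ->
  exists D w : 'rV[C]_N, [/\ forall i, D 0 i \is Num.real /\ eigenvalue A (D 0 i),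
    (v *m A *m map_mx Num.conj v^T) 0 0 = \sum_i D 0 i * `|w 0 i| ^+ 2 &
    (v *m map_mx Num.conj v^T) 0 0 = \sum_i `|w 0 i| ^+ 2].
Proof.
move=> hA; pose P := spectralmx A; pose D := spectral_diag A.
have UP : P \is unitarymx := spectral_unitarymx A.
have /orthomx_spectralP : A \is normalmx by exact: hermitian_normalmx.
rewrite /= -/P -/D (invmx_unitary UP) => EA.
have PA : P *m A = diag_mx D *m P.
  by rewrite {1}EA !mulmxA (unitarymxP UP) mul1mx.
pose w := v *m (map_mx Num.conj P^T).
have Ew : map_mx Num.conj w^T = P *m map_mx Num.conj v^T.
  rewrite /w trmx_mul map_mxM; congr (_ *m _); apply/matrixP => i j.
  by rewrite !mxE; exact: conjCK.
have PtP : map_mx Num.conj P^T *m P = 1%:M.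
  by rewrite -(invmx_unitary UP) mulVmx// spectral_unit.
exists D, w; split=> [i||].
- split; first by have /mxOverP := hermitian_spectral_diag_real hA; exact.
  apply/eigenvalueP; exists (row i P).
    by rewrite -row_mul PA row_mul row_diag_mx -scalemxAl -rowE.
  rewrite rowE; apply/eqP => /(congr1 (mulmx^~ (invmx P))).
  rewrite mulmxK ?spectral_unit// mul0mx => /matrixP/(_ 0 i)/eqP.
  by rewrite !mxE !eqxx oner_eq0.
- have -> : v *m A *m map_mx Num.conj v^T = w *m diag_mx D *m map_mx Num.conj w^T.
    by rewrite Ew {1}EA !mulmxA.
  rewrite mxE; apply: eq_bigr => i _.
  by rewrite mul_mx_diag !mxE normCK [in RHS]mulrCA mulrA.
- have -> : v *m map_mx Num.conj v^T = w *m map_mx Num.conj w^T.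
    by rewrite Ew /w mulmxA -(mulmxA v) PtP mulmx1.
  by rewrite mxE; apply: eq_bigr => i _; rewrite !mxE normCK.
Qed.

Section SymmetricMatrix.
Variables (R : realType) (N : nat).
Implicit Types (A : 'M[R]_N) (v : 'rV[R]_N).

(** Rayleigh's principle by complexification: the eigenvalues of the complexified matrix are real,
    hence lie in the spectrum of [A], and each term of the diagonal form is bounded separately. *)
Lemma quadratic_form_le_max_spectrum A v : A^T = A ->
  (v *m A *m v^T) 0 0 <= max_spectrum A * (v *m v^T) 0 0.
Proof.
move=> AT; have [N0|N0] := posnP N.
  have v0 : v = 0 by apply/rowP => i; have := ltn_ord i; rewrite {2}N0.
  by rewrite v0 !mul0mx mxE mulr0.
have [_ ubA] := max_spectrumP N0 AT.
pose f := real_complex R; pose A' := map_mx f A.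
have fC x : Num.conj (f x) = f x by exact: conjc_real.
have hA : A' \is hermsymmx.
  apply/is_hermitianmxP; rewrite expr0 scale1r.
  by apply/matrixP => i j; rewrite !mxE fC -[in RHS]AT mxE.
have [D [w [HD]]] := hermitian_quadratic_form (map_mx f v) hA.
have -> : map_mx Num.conj (map_mx f v)^T = map_mx f v^T.
  by apply/matrixP => i j; rewrite !mxE; exact: fC.
rewrite -!map_mxM 2![map_mx _ _ _ _]mxE => E1 E2.
rewrite -lecR rmorphM /= [X in X <= _]E1 [X in _ <= _ * X]E2 mulr_sumr.
apply: ler_sum => i _; apply: ler_wpM2r; first by rewrite exprn_ge0.
have [/complex_realP[x Dx]] := HD i; rewrite Dx lecR eigenvalue_map => Ax.
exact: ubA.
Qed.

Lemma diag_le_max_spectrum A i : A^T = A -> A i i <= max_spectrum A.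
Proof.
move=> /(quadratic_form_le_max_spectrum (delta_mx 0 i)).
have -> : delta_mx 0 i *m A *m (delta_mx 0 i)^T = (A i i)%:M :> 'M[R]_1.
  by apply/matrixP => j k; rewrite !ord1 trmx_delta -rowE -colE !mxE eqxx.
have -> : delta_mx 0 i *m (delta_mx 0 i)^T = 1%:M :> 'M[R]_1.
  by rewrite trmx_delta mul_delta_mx; apply/matrixP => j k; rewrite !ord1 !mxE !eqxx.
by rewrite !mxE !eqxx mulr1.
Qed.

(** Gershgorin's argument: read the eigenvalue equation of the top eigenvalue [l] at an index [i]
    where the eigenvector has largest modulus; dividing by [|v_i|] bounds [l - A i i] by the
    off-diagonal row sum. *)
Lemma max_spectrum_le_gershgorin A (t c : R) : (0 < N)%N -> A^T = A ->
  (forall i, A i i <= t) -> (forall i, \sum_(j | j != i) `|A i j| <= c) ->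
  max_spectrum A <= t + c.
Proof.
move=> N0 AT At Ac; have [/eigenvalueP[v vA v0] _] := max_spectrumP N0 AT.
set l := max_spectrum A in vA *.
pose i := [arg max_(k > Ordinal N0) `|v 0 k|]%O.
have vi k : `|v 0 k| <= `|v 0 i|.
  by rewrite /i; case: arg_maxP => // j _; exact.
have vi0 : 0 < `|v 0 i|.
  rewrite normr_gt0; apply: contra v0 => /eqP v0; apply/eqP/rowP => k.
  by rewrite mxE; apply/eqP; rewrite -normr_le0 (le_trans (vi k))// v0 normr0.
have : l * v 0 i = A i i * v 0 i + \sum_(j | j != i) v 0 j * A i j.
  transitivity ((v *m A) 0 i); first by rewrite vA mxE.
  rewrite mxE (bigD1 i)//= mulrC; congr (_ + _); apply: eq_bigr => j _.
  by rewrite -{1}AT mxE.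
move=> vi_eq; have E : \sum_(j | j != i) v 0 j * A i j = (l - A i i) * v 0 i.
  by rewrite mulrBl vi_eq addrAC subrr add0r.
suff : l - A i i <= c by rewrite lerBlDl => /le_trans; apply; rewrite lerD2r.
rewrite -(ler_pM2r vi0) (le_trans (ler_norm _))// normrM normr_id -normrM -E.
rewrite (le_trans (ler_norm_sum _ _ _))//.
apply: (@le_trans _ _ (\sum_(j | j != i) `|A i j| * `|v 0 i|)).
  by apply: ler_sum => j _; rewrite normrM mulrC ler_wpM2l.
by rewrite -mulr_suml ler_wpM2r.
Qed.

End SymmetricMatrix.

Section QuadraticForm.
Variables (R : realType) (N : nat).
Implicit Types (A : 'M[R]_N) (v : 'rV[R]_N).

Lemma quadratic_formE A v :
  (v *m A *m v^T) 0 0 = \sum_i \sum_j v 0 i * A i j * v 0 j.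
Proof.
rewrite mxE exchange_big; apply: eq_bigr => j _ /=.
by rewrite !mxE -mulr_suml.
Qed.

(* Integer test vectors make this a countable family of conditions. *)
Lemma max_spectrum_leP A (t : R) : (0 < N)%N -> A^T = A ->
  max_spectrum A <= t <->
  forall z : 'rV[int]_N, 
    \sum_i \sum_j (z 0 i)%:~R * A i j * (z 0 j)%:~R <= t * \sum_i (z 0 i)%:~R ^+ 2.
Proof.
move=> N0 AT; split=> [lt z|Hz].
  pose v : 'rV[R]_N := map_mx intr z.
  have := quadratic_form_le_max_spectrum v AT.
  rewrite quadratic_formE (_ : (v *m v^T) 0 0 = \sum_i v 0 i ^+ 2); last first.
    by rewrite mxE; apply: eq_bigr => i _; rewrite [v^T _ _]mxE expr2.
  under eq_bigr do under eq_bigr do rewrite !mxE.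
  under [X in _ * X]eq_bigr do rewrite !mxE.
  move=> /le_trans; apply; apply: ler_wpM2r => //.
  by apply: sumr_ge0 => i _; exact: sqr_ge0.
have [/eigenvalueP[v vA v0] _] := max_spectrumP N0 AT.
(* Approximate the eigenvector by rational vectors of denominator [k + 1]. Both sides are
   homogeneous of degree 2, so the hypothesis on integer vectors applies to them and passes to the
   limit. *)
pose u k i : R := (Num.floor (k.+1%:R * v 0 i))%:~R / k.+1%:R.
have uv i : u k i @[k --> \oo] --> v 0 i.
  apply: (@squeeze_cvgr _ _ _ _ (fun k => v 0 i - k.+1%:R^-1) (fun=> v 0 i)).
  - apply: nearW => k; rewrite /u ler_pdivlMr ?ltr0n// ler_pdivrMr ?ltr0n//.
    rewrite mulrBl mulVf ?pnatr_eq0// lerBlDr [v 0 i * _]mulrC.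

    by have := floor_itv (k.+1%:R * v 0 i); rewrite intrD => /andP[-> /ltW ->].
  - rewrite -[X in _ --> X]subr0; apply: cvgB; first exact: cvg_cst.
    exact: cvg_harmonic.
  - exact: cvg_cst.
have lhs : \sum_i \sum_j u k i * A i j * u k j @[k --> \oo] -->
    \sum_i \sum_j v 0 i * A i j * v 0 j.
  apply: cvg_sumr => i; apply: cvg_sumr => j.
  by apply: cvgM => //; apply: cvgM => //; exact: cvg_cst.
have rhs : t * (\sum_i u k i ^+ 2) @[k --> \oo] --> t * \sum_i v 0 i ^+ 2.
  apply: cvgM; first exact: cvg_cst.
  by apply: cvg_sumr => i; rewrite expr2; apply: cvgM.
have : \sum_i \sum_j v 0 i * A i j * v 0 j <= t * \sum_i v 0 i ^+ 2.
  apply: (ler_cvg_to lhs rhs); apply: nearW => k.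
  have := Hz (\row_i Num.floor (k.+1%:R * v 0 i)).
  under eq_bigr do under eq_bigr do rewrite !mxE.
  under [X in _ <= _ * X]eq_bigr do rewrite mxE.
  move=> Hk; have k0 : 0 < k.+1%:R ^- 2 :> R by rewrite invr_gt0 exprn_gt0.
  rewrite -(ler_pM2l k0) in Hk; move: Hk; congr (_ <= _).
    rewrite mulr_sumr; apply: eq_bigr => i _; rewrite mulr_sumr.
    by apply: eq_bigr => j _; rewrite /u expr2 invfM; ring.
  rewrite mulrCA; congr (_ * _); rewrite mulr_sumr; apply: eq_bigr => i _.
  by rewrite /u exprMn exprVn mulrC.
rewrite -quadratic_formE vA -scalemxAl mxE (_ : (v *m v^T) 0 0 = \sum_i v 0 i ^+ 2); last first.
    by rewrite mxE; apply: eq_bigr => i _; rewrite [v^T _ _]mxE expr2.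
rewrite ler_pM2r// lt_neqAle sumr_ge0 ?andbT => [|i _]; last exact: sqr_ge0.
apply: contra v0 => /eqP/esym/eqP; rewrite psumr_eq0 => [/allP v0|i _]; last exact: sqr_ge0.
apply/eqP/rowP => i; rewrite mxE; apply/eqP; rewrite -sqrf_eq0.
exact: (implyP (v0 i (mem_index_enum i))).
Qed.

Lemma min_spectrumN A : min_spectrum A = - max_spectrum (- A).
Proof.
rewrite /min_spectrum /max_spectrum /inf; congr (- sup _).
rewrite /spectrum; apply/seteqP; split => x /=.
  move=> [y /eigenvalueP[v vA v0] <-]; apply/eigenvalueP; exists v => //.
  by rewrite mulmxN vA scaleNr.
move=> /eigenvalueP[v vA v0]; exists (- x); rewrite ?opprK//.
by apply/eigenvalueP; exists v => //; rewrite scaleNr -vA mulmxN opprK.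
Qed.

End QuadraticForm.

(** * Sums over cubes *)

(** With [K = 2LM + L + M] one has [2K + 1 = (2L + 1)(2M + 1)]. This lemma and the next two make
    [(a, b) -> a (2L + 1) + b] a bijection from [[-M, M] x [-L, L]] onto [[-K, K]]: division with
    centred remainder. *)
Lemma norm_dilation_le (a b : int) (L M : nat) : `|a| <= M%:Z -> `|b| <= L%:Z ->
  `|a * (2 * L + 1)%:Z + b| <= (2 * L * M + L + M)%:Z.
Proof.
move=> aM bL. rewrite (le_trans (ler_normD _ _))// normrM.
have : `|a| * `|(2 * L + 1)%:Z| <= M%:Z * (2 * L + 1)%:Z by rewrite ler_wpM2r.
 lia.
Qed.
Lemma dilation_inj (a b a' b': int) (L : nat) : `|b| <= L%:Z -> `|b'| <= L%:Z ->
  a * (2 * L + 1)%:Z + b = a' * (2 * L + 1)%:Z + b' -> a = a'.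
Proof.
move=> bL b'L E.
have E2 : (a - a') * (2 * L + 1)%:Z = b' - b by rewrite mulrBl; lia.
have : `|a - a'| * (2 * L + 1)%:Z = `|b' - b| by rewrite -E2 normrM.
(* For distinct [a], [a'] the left side is at least [2L + 1], the right side at most [2L]. *)
have [->//|] := eqVneq a a'.
nia.
Qed.
Lemma dilation_onto (n : int) (L M : nat) : `|n| <= (2 * L * M + L + M)%:Z ->
  exists a b : int, [/\ n = a * (2 * L + 1)%:Z + b, `|a| <= M%:Z & `|b| <= L%:Z].
Proof.
move=> nK; set m := (2 * L + 1)%:Z; have m0 : m != 0 by lia.
(* Shifting by [L] turns the centred remainder into the usual one, in [[0, 2L]]. *)
pose a := ((n + L%:Z) %/ m)%Z; pose b := ((n + L%:Z) %% m)%Z.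
have b0 : 0 <= b by exact: modz_ge0.
have bm : b < m by apply: ltz_pmod; lia.
have E : n + L%:Z = a * m + b by exact: divz_eq.
exists a, (b - L%:Z); split; [lia| |lia].
suff : `|a| * m < (M%:Z + 1) * m by rewrite ltr_pM2r; lia.
have -> : `|a| * m = `|a * m| by rewrite normrM.
have -> : a * m = n + L%:Z - b by rewrite E addrK.
rewrite [ltRHS](_ : _ = (2 * L * M + L + M)%:Z + L%:Z + 1); last by rewrite /m; lia.
lia.
Qed.

Section CubeSums.
Variables (R : realType) (d : nat).
Implicit Types (n q r : lattice d) (F : lattice d -> R).

Lemma mem_cubeP L n : reflect (forall i, `|n i| <= L%:Z) (n \in fset_set (cube L)).
Proof.
rewrite in_fset_set; last exact: finite_cube.
by apply: (iffP idP) => [|nL]; rewrite inE.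
Qed.

(** Shifting coordinates by [L] identifies the cube with a finite function type, where points can be
    counted and sums of products factored coordinate by coordinate. *)
Lemma cube_sumE L F : \sum_(n <- fset_set (cube L)) F n =
  \sum_(g : {ffun 'I_d -> 'I_(2 * L).+1}) F [ffun i => (g i)%:Z - L%:Z].
Proof.
rewrite -fsbig_finite; last exact: finite_cube.
pose h (g : {ffun 'I_d -> 'I_(2 * L).+1}) : lattice d := [ffun i => (g i)%:Z - L%:Z].
rewrite (reindex_fsbig h [set` index_enum {ffun 'I_d -> 'I_(2 * L).+1}]).
  by rewrite -fsbig_seq// index_enum_uniq.
split=> [g _ i|g g' _ _ /ffunP hg|n nL].
- rewrite ffunE ler_norml; case: (g i) => a /= aL; lia.
- apply/ffunP => i; apply: val_inj; have := hg i; rewrite !ffunE => /eqP.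
  by rewrite (inj_eq (addIr _)) => /eqP[].
- exists [ffun i => inord `|(n i + L%:Z)%R|%N] => /=; first exact: mem_index_enum.
  apply/ffunP => i; rewrite !ffunE; move: (n i) (nL i) => a aL.
  by rewrite inordK; lia.
Qed.

Lemma cube_sum_const L (c : R) :
  \sum_(n <- fset_set (@cube d L)) c = c * (2 * L + 1)%:R ^+ d.
Proof.
by rewrite cube_sumE sumr_const card_ffun !card_ord -[LHS]mulr_natr natrX addn1.
Qed.

Lemma cube_sum_dilation L M F :
  \sum_(n <- fset_set (cube (2 * L * M + L + M))) F n =
  \sum_(q <- fset_set (cube M)) \sum_(r <- fset_set (cube L))
    F (q *+ (2 * L + 1) + r).
Proof.
rewrite -!fsbig_finite; [|exact: finite_cube..].
rewrite [RHS](eq_fsbigr (fun q => \sum_(r \in cube L) F (q *+ (2 * L + 1) + r))); last first.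
  by move=> q _; rewrite -fsbig_finite//; exact: finite_cube.
rewrite pair_fsbig; [|exact: finite_cube..].
have D q r i : (q *+ (2 * L + 1) + r) i = q i * (2 * L + 1)%:Z + r i.
  by rewrite ffunE ffunMnE -mulr_natr natz.
apply: reindex_fsbig; split=> [[q r] [/= qM rL] i|[q r] [q' r']|n nK].
- by rewrite D norm_dilation_le.
- rewrite !inE => -[/= qM rL] [/= q'M r'L] qr.
  have E i : q i = q' i /\ r i = r' i.
    have E1 : q i * (2 * L + 1)%:Z + r i = q' i * (2 * L + 1)%:Z + r' i.
      by rewrite -!D qr.
    have E2 := dilation_inj (rL i) (r'L i) E1.
    by split=> //; move: E1; rewrite E2 => /addrI.
  by congr pair; apply/ffunP => i; case: (E i).
- have /choice[q /choice[r qr]] i := dilation_onto (nK i).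
  exists (finfun q, finfun r); last first.
    by apply/ffunP => i; rewrite D !ffunE; case: (qr i).
  by split=> i /=; rewrite ffunE; case: (qr i).
Qed.

Lemma cube_sumB L K F : (L <= K)%N ->
  \sum_(n <- fset_set (cube K)) F n - \sum_(n <- fset_set (cube L)) F n =
  \sum_(n <- fset_set (cube K) | n \notin fset_set (cube L)) F n.
Proof.
move=> LK; rewrite (bigID (mem (fset_set (cube L))))/= addrC; apply/eqP.
rewrite subr_eq; apply/eqP; congr (_ + _); rewrite -big_filter; apply: perm_big.
apply: uniq_perm; [exact/filter_uniq/fset_uniq|exact: fset_uniq|] => n; rewrite mem_filter.
case: (boolP (n \in fset_set (cube L))) => //= /mem_cubeP nL; apply/mem_cubeP => i.
by rewrite (le_trans (nL i)).
Qed.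

Lemma cube_sum_le_mono L K F : (L <= K)%N -> (forall n, 0 <= F n) ->
  \sum_(n <- fset_set (cube L)) F n <= \sum_(n <- fset_set (cube K)) F n.
Proof. by move=> LK F0; rewrite -subr_ge0 cube_sumB// sumr_ge0. Qed.

End CubeSums.

(** * Lattice norms and dilations *)

Section LatticeNorm.
Variables (R : realType) (d : nat) (nrm : lattice d -> R).
Hypothesis nrmE : nrm = @l1_norm R d \/ nrm = @l2_norm R d.
Implicit Types n q r : lattice d.

Lemma lattice_norm_ge0 n : 0 <= nrm n.
Proof. by case: nrmE => ->; [apply: sumr_ge0|apply: sqrtr_ge0]. Qed.

Lemma lattice_normMn q c : nrm (q *+ c) = c%:R * nrm q.
Proof.
case: nrmE => ->.
  rewrite /l1_norm mulr_sumr; apply: eq_bigr => i _.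
  by rewrite ffunMnE rmorphMn /= normrMn mulr_natl.
rewrite /l2_norm -[c%:R in RHS]ger0_norm// -sqrtr_sqr -sqrtrM ?sqr_ge0//; congr Num.sqrt.
rewrite mulr_sumr; apply: eq_bigr => i _.
by rewrite ffunMnE rmorphMn /= -exprMn mulr_natl.
Qed.

Lemma lattice_norm0 : nrm 0 = 0.
Proof. by have := lattice_normMn 0 0; rewrite mulr0n mul0r. Qed.

(* For the Euclidean norm, divide |a|^2 - |b|^2 <= l1 (a - b) * (|a| + |b|)
   by |a| + |b|. *)
Lemma lattice_norm_sub_le n q : nrm n - nrm q <= l1_norm R (n - q).
Proof.
have coord := @coord_le_norm R d nrm _ _ nrmE.
case: nrmE => E; rewrite E.
  rewrite lerBlDr /l1_norm -big_split; apply: ler_sum => i _ /=.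
  by rewrite -[n in leLHS](subrK q) ffunE rmorphD/= ler_normD.
rewrite -E; have [S0|S0] := leP (nrm n + nrm q) 0.
  rewrite (@le_trans _ _ 0)//; last by apply: sumr_ge0.
  by have := lattice_norm_ge0 n; have := lattice_norm_ge0 q; lra.
rewrite -(ler_pM2r S0) -subr_sqr.
have sq k : nrm k ^+ 2 = \sum_i (k i)%:~R ^+ 2.
  by rewrite E sqr_sqrtr// sumr_ge0// => i _; exact: sqr_ge0.
rewrite !sq -sumrB /l1_norm mulr_suml; apply: ler_sum => i _.
rewrite subr_sqr (le_trans (ler_norm _))// normrM !ffunE rmorphB/= ler_wpM2l//.
by rewrite (le_trans (ler_normD _ _))// lerD.
Qed.

Lemma lattice_norm_le_l1 n : nrm n <= l1_norm R n.
Proof.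
by have := lattice_norm_sub_le n 0; rewrite lattice_norm0 !subr0.
Qed.

Lemma l1_norm_cube_le L n : n \in fset_set (cube L) -> l1_norm R n <= d%:R * L%:R.
Proof.
move=> /mem_cubeP nL; rewrite /l1_norm mulr_natl.
rewrite (le_trans (ler_sum _ (G := fun=> L%:R) _))//; last first.
  by rewrite sumr_const card_ord.
by move=> i _; rewrite -intr_norm -[L%:R]/(L%:Z%:~R) ler_int.
Qed.

(** By homogeneity the norm of [q (2L + 1)] is exact, and adding [r] changes it by at most the l1
    norm of [r]. *)
Lemma dilation_norm_sub_le L q r : r \in fset_set (cube L) ->
  `|nrm (q *+ (2 * L + 1) + r) - (2 * L + 1)%:R * nrm q| <= d%:R * L%:R.
Proof.
move=> /l1_norm_cube_le rL; rewrite -lattice_normMn ler_norml lerNl opprB.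
rewrite 2?(le_trans (lattice_norm_sub_le _ _))//; first by rewrite addrAC subrr add0r.
by rewrite opprD addrA subrr add0r /l1_norm; under eq_bigr do rewrite ffunE rmorphN normrN.
Qed.

(** The additive error [d L] of [dilation_norm_sub_le] may swamp a small [q], so a multiplicative
    bound is obtained coordinatewise: [|q_i| (2L + 1) <= 2 |n_i|], because [|r_i| <= L] is less than
    half of [2L + 1]. Summing [d] coordinates, each at most the norm of [n], gives the factor
    [2d]. *)
Lemma dilation_norm_ge L q r : r \in fset_set (cube L) ->
  (2 * L + 1)%:R * nrm q <= (2 * d)%:R * nrm (q *+ (2 * L + 1) + r).
Proof.
move=> /mem_cubeP rL; set n := q *+ _ + r.
apply: (@le_trans _ _ ((2 * L + 1)%:R * l1_norm R q)).
  by rewrite ler_wpM2l// lattice_norm_le_l1.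
have -> : (2 * d)%:R * nrm n = \sum_(i < d) 2 * nrm n.
  by rewrite sumr_const card_ord -[in RHS]mulr_natl natrM; ring.
rewrite mulr_sumr; apply: ler_sum => i _.
rewrite (@le_trans _ _ (2 * `|(n i)%:~R|))// ?ler_wpM2l ?coord_le_norm//.
rewrite -!intr_norm -[2]/(2%:~R) -[(2 * L + 1)%:R]/((2 * L + 1)%:Z%:~R) -!intrM ler_int.
rewrite /n ffunE ffunMnE; have := rL i.
move: (q i) (r i) => a b bL; rewrite -mulr_natr natz.
have [->|a0] := eqVneq a 0; first by lia.
have : `|a| * (2 * L + 1)%:Z <= `|a * (2 * L + 1)%:Z + b| + L%:Z.
  rewrite -[X in `|a| * X <= _]ger0_norm// -normrM -[X in `|X| <= _](addrK b).
  by rewrite (le_trans (ler_normB _ _))// lerD2l.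
nia.
Qed.

End LatticeNorm.

(** * Powers and power sums *)

Section Powers.
Variable R : realType.
Implicit Types a m s u x y : R.

Lemma gt0_powRD a s x : 0 < x -> x `^ (a + s) = x `^ a * x `^ s.
Proof. by move=> x0; rewrite powRD// (gt_eqF x0) implybT. Qed.

Lemma powR_ge1Dln a u : 0 < u -> 1 + a * ln u <= u `^ a.
Proof. by move=> u0; rewrite /powR gt_eqF// expR_ge1Dx. Qed.

Lemma ln_le_subr1 u : 0 < u -> ln u <= u - 1.
Proof.
move=> u0; have := @le_ln1Dx _ (u - 1); rewrite subrKC; apply; lra.
Qed.

Lemma ln_ge_1Binv u : 0 < u -> 1 - u^-1 <= ln u.
Proof.
move=> u0; have := @ln_le_subr1 u^-1; rewrite invr_gt0 lnV ?posrE// => /(_ u0).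
by lra.
Qed.

(** The convex function [t^(-s)] lies above its tangent at [x]. With [u = y / x] this reads
    [u^(-s) >= 1 - s ln u >= 1 - s (u - 1)]. *)
Lemma powRN_tangent s x y : 0 <= s -> 0 < x -> 0 < y ->
  x `^ (- s) - y `^ (- s) <= s * x `^ (- s - 1) * (y - x).
Proof.
move=> s0 x0 y0; have yx : 0 < y / x by exact: divr_gt0.
have E : y `^ (- s) = x `^ (- s) * (y / x) `^ (- s).
  by rewrite -powRM ?ltW// mulrCA divff ?mulr1 ?gt_eqF.
have -> : x `^ (- s - 1) = x `^ (- s) * x^-1.
  by rewrite gt0_powRD// powR_inv1// ltW.
have H : 1 - s * (y / x - 1) <= (y / x) `^ (- s).
  rewrite (le_trans _ (powR_ge1Dln _ yx))// mulNr lerD2l lerN2 ler_wpM2l//.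
  exact: ln_le_subr1.
rewrite E -[X in X - _]mulr1 -mulrBr.
have -> : s * (x `^ (- s) / x) * (y - x) = x `^ (- s) * (s * (y / x - 1)).
  by field; rewrite gt_eqF.
by rewrite ler_pM2l ?powR_gt0// lerBlDr -lerBlDl.
Qed.

Lemma powRN_le s x y : 0 <= s -> 0 < x -> x <= y -> y `^ (- s) <= x `^ (- s).
Proof.
move=> s0 x0 xy; have y0 := lt_le_trans x0 xy.
by rewrite !powRN lef_pV2 ?posrE ?powR_gt0// ge0_ler_powR// nnegrE ltW.
Qed.

(** A mean-value bound: the tangent inequality in both directions, the slope being largest at the
    left end [m]. *)
Lemma dist_powRN_le s m x y : 0 <= s -> 0 < m -> m <= x -> m <= y ->
  `|x `^ (- s) - y `^ (- s)| <= s * m `^ (- s - 1) * `|x - y|.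
Proof.
move=> s0 m0; have H x' y' : m <= x' -> m <= y' ->
    x' `^ (- s) - y' `^ (- s) <= s * m `^ (- s - 1) * `|x' - y'|.
  move=> mx my; have x0 := lt_le_trans m0 mx; have y0 := lt_le_trans m0 my.
  rewrite (le_trans (powRN_tangent s0 x0 y0))// -!mulrA ler_wpM2l//.
  apply: (@le_trans _ _ (x' `^ (- s - 1) * `|x' - y'|)).
    by rewrite ler_wpM2l ?powR_ge0// distrC ler_norm.
  by rewrite ler_wpM2r// -opprD powRN_le// addr_ge0.
by move=> mx my; rewrite ler_norml lerNl opprB H// distrC H.
Qed.

Lemma powRN_cvg0 s (T : Type) (F : set_system T) {FF : Filter F} (f : T -> R) :
  0 < s -> f x @[x --> F] --> +oo -> f x `^ (- s) @[x --> F] --> 0.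
Proof.
move=> s0 foo; apply/cvgrPdist_lt => e e0.
have [f0 fe] : (\forall x \near F, 0 < f x) /\ (\forall x \near F, e `^ (- s^-1) < f x).
  by split; move/cvgryPgt : foo; exact.
near=> x; rewrite sub0r normrN ger0_norm ?powR_ge0//.
have fx : e `^ (- s^-1) < f x by near: x.
have fx0 : 0 < f x by near: x.
have -> : e = (e `^ (- s^-1)) `^ (- s).
  by rewrite -powRrM mulrNN mulVf ?gt_eqF// powRr1// ltW.
rewrite !powRN ltf_pV2 ?posrE ?invr_gt0 ?powR_gt0//; last first.
  by rewrite invr_gt0 powR_gt0.
by apply: gt0_ltr_powR => //; rewrite ?nnegrE -?powRN ?powR_ge0// ltW.
Unshelve. all: by end_near. Qed.

Lemma odd_cvgy : (2 * L + 1)%:R @[L --> \oo] --> (+oo : set_system R).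
Proof.
apply: (@ger_cvgy _ _ _ _ (fun L => L%:R)); last exact: cvgr_idn.
by apply: nearW => L; rewrite ler_nat; lia.
Qed.

Lemma odd_powR_cvg0 s : 0 < s -> (2 * L + 1)%:R `^ (- s) @[L --> \oo] --> (0 : R).
Proof. by move=> s0; apply: powRN_cvg0 => //; exact: odd_cvgy. Qed.

End Powers.

Section PowerSums.
Variable R : realType.

(** A discrete comparison with the integral of [x^(-p)]: by induction, each new term is at most the
    increment of the right-hand side. *)
Lemma sum_powRN_lt1 (p : R) : 0 <= p < 1 ->
  exists2 C, 0 < C & forall M, \sum_(k < M.+1) (1 + k%:R) `^ (- p) <= C * (1 + M%:R) `^ (1 - p).
Proof.
move=> /andP[p0 p1]; pose t := 1 - p; have t0 : 0 < t by rewrite subr_gt0.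
(* The base case needs [C >= 1]. The induction step needs [C t / 2 >= 1], since from [x] to [x + 1]
   the power [x^t] grows by at least [(t / 2) (x + 1)^(-p)]. *)
exists (1 + 2 / t); first by rewrite addr_gt0// divr_gt0.
elim=> [|M IH].
  by rewrite big_ord1 addr0 !powR1 mulr1 lerDl divr_ge0// ltW.
rewrite big_ord_recr /= (le_trans (lerD IH (lexx _)))//.
set x : R := 1 + M%:R; have x0 : 0 < x by rewrite /x; have := ler0n R M; lra.
have -> : 1 + M.+1%:R = x + 1 by rewrite /x -natr1 addrA.
rewrite -lerBrDl -mulrBr -/t.
have y0 : 0 < x + 1 by lra.
have E1 : (x + 1) `^ (- p) = (x + 1) `^ t / (x + 1).
  rewrite -[(x + 1)^-1]powR_inv1 ?ltW// -gt0_powRD//.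
  by congr (_ `^ _); rewrite /t; ring.
have E2 : x `^ t <= (x + 1) `^ t / (1 + t / (x + 1)).
  rewrite ler_pdivlMr ?addr_gt0 ?divr_gt0//.
  (* [u^t >= 1 + t ln u] and [ln u >= 1 - 1/u], at [u = (x + 1) / x]. *)
  have H : 1 + t / (x + 1) <= ((x + 1) / x) `^ t.
    have u0 : 0 < (x + 1) / x by rewrite divr_gt0.
    rewrite (le_trans _ (powR_ge1Dln t u0))// lerD2l ler_pM2l//.
    rewrite (le_trans _ (ln_ge_1Binv u0))// invf_div le_eqVlt.
    by apply/orP; left; apply/eqP; field; rewrite gt_eqF.
  apply: (le_trans (ler_wpM2l (powR_ge0 _ _) H)).
  rewrite -powRM ?divr_ge0// ?(ltW x0) ?(ltW y0)//.
  by rewrite mulrCA divff ?mulr1// gt_eqF.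
rewrite E1; set Y := (x + 1) `^ t in E2 *.
have Y0 : 0 < Y by rewrite powR_gt0.
have x1 : 1 <= x by rewrite /x; have := ler0n R M; lra.
(* This is [1 / (1 + v) <= 1 - v / 2] for [0 <= v <= 1], at [v = t / (x + 1)]. *)
have E3 : Y / (1 + t / (x + 1)) <= Y - Y * t / 2 / (x + 1).
  rewrite ler_pdivrMr ?addr_gt0 ?divr_gt0//.
  have v1 : t / (x + 1) <= 1 by rewrite ler_pdivrMr// /t; lra.
  have v0 : 0 <= t / (x + 1) by rewrite divr_ge0// ltW.
  have -> : Y * t / 2 / (x + 1) = Y * (t / (x + 1) / 2) by ring.
  set v := t / (x + 1) in v0 v1 *.
  have -> : (Y - Y * (v / 2)) * (1 + v) = Y * (1 + v / 2 * (1 - v)) by field.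
  by rewrite ler_peMr ?(ltW Y0)// lerDl; apply: mulr_ge0; [exact: divr_ge0|rewrite subr_ge0].
apply: (@le_trans _ _ ((1 + 2 / t) * (Y * t / 2 / (x + 1)))); last first.
  apply: ler_wpM2l; first by rewrite addr_ge0// divr_ge0// (ltW t0).
  rewrite lerBrDr -lerBrDl; exact: le_trans E2 E3.
have -> : (1 + 2 / t) * (Y * t / 2 / (x + 1)) = Y * t / 2 / (x + 1) + Y / (x + 1).
  by field; rewrite !gt_eqF.
by rewrite lerDr !divr_ge0// ?mulr_ge0// ltW.
Qed.

(** With [s = p - 1], the tangent inequality at [x + 1] bounds [(x + 1)^(-p)] by
    [(x^(-s) - (x + 1)^(-s)) / s], which telescopes; the induction keeps the remainder
    [(1 + M)^(-s) / s]. *)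
Lemma sum_powRN_gt1 (p : R) : 1 < p ->
  exists2 C, 0 < C & forall M, \sum_(k < M.+1) (1 + k%:R) `^ (- p) <= C.
Proof.
move=> p1; pose s := p - 1; have s0 : 0 < s by rewrite subr_gt0.
suff H M : \sum_(k < M.+1) (1 + k%:R) `^ (- p) <= 1 + s^-1 - (1 + M%:R) `^ (- s) / s.
  exists (1 + s^-1); first by rewrite addr_gt0// invr_gt0.
  by move=> M; rewrite (le_trans (H M))// gerBl divr_ge0 ?powR_ge0// ltW.
elim: M => [|M IH].
  by rewrite big_ord1 addr0 !powR1 mul1r addrK.
rewrite big_ord_recr /= (le_trans (lerD IH (lexx _)))//.
set x : R := 1 + M%:R; have x0 : 0 < x by rewrite /x; have := ler0n R M; lra.
have -> : 1 + M.+1%:R = x + 1 by rewrite /x -natr1 addrA.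
have H : (x + 1) `^ (- p) <= (x `^ (- s) - (x + 1) `^ (- s)) / s.
  rewrite ler_pdivlMr//; have := @powRN_tangent _ s (x + 1) x (ltW s0).
  rewrite (_ : - s - 1 = - p); last by rewrite /s; ring.
  by rewrite addr_gt0// => /(_ isT x0); lra.
by rewrite (le_trans (lerD (lexx _) H))// mulrBl; lra.
Qed.

End PowerSums.

(** * Dilation of the weight sums *)

Lemma dilation_size L M : (2 * (2 * L * M + L + M) + 1 = (2 * L + 1) * (2 * M + 1))%N.
Proof. lia. Qed.

Section WeightSums.
Variables (R : realType) (d : nat) (nrm : lattice d -> R).
Hypothesis nrmE : nrm = @l1_norm R d \/ nrm = @l2_norm R d.
Hypothesis d_gt0 : (0 < d)%N.
Implicit Types (n q r : lattice d) (s : R) (L M : nat).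

Definition weight_sum s L := \sum_(n <- fset_set (cube L)) (1 + nrm n) `^ (- s).

Let dR : (0 : R) < d%:R. Proof. by rewrite ltr0n. Qed.
Let nrm1 n : 1 <= 1 + nrm n. Proof. by rewrite lerDl lattice_norm_ge0. Qed.
Let nrm1_gt0 n : 0 < 1 + nrm n. Proof. by rewrite (lt_le_trans ltr01). Qed.

Lemma weight_sum_ge0 s L : 0 <= weight_sum s L.
Proof. by apply: sumr_ge0 => n _; exact: powR_ge0. Qed.

Lemma sum_segment_le (F : nat -> R) M : (forall k, 0 <= F k) ->
  \sum_(j < (2 * M).+1) F `|(j%:Z - M%:Z)|%N <= 2 * \sum_(k < M.+1) F k.
Proof.
move=> F0; rewrite -(big_mkord xpredT (fun j => F `|j%:Z - M%:Z|%N)).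
rewrite (@big_cat_nat _ _ _ M)//=; last by lia.
rewrite mulr_natl mulr2n lerD//.
  rewrite big_mkord big_ord_recl /= (reindex_inj rev_ord_inj) /=.
  rewrite (eq_bigr (fun i : 'I_M => F (bump 0 i))).
    by rewrite lerDr.
  by move=> i _; congr F; rewrite /bump /=; have := ltn_ord i; lia.
rewrite -{1}[M]add0n big_addn -(big_mkord xpredT F) (_ : ((2 * M).+1 - M = M.+1)%N); last by lia.
by apply: ler_sum => i _; rewrite (_ : `|(i + M)%N%:Z - M%:Z|%N = i)//; lia.
Qed.

(** Since [1 + |n|] is at least every [1 + |n_i|], the weight is at most the product over [i] of
    [(1 + |n_i|)^(-s/d)]. The sum of this product over the cube factors into [d] one-dimensional
    sums. *)
Lemma weight_sum_le_prod s M : 0 <= s ->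
  weight_sum s M <= (2 * \sum_(k < M.+1) (1 + k%:R) `^ (- (s / d%:R))) ^+ d.
Proof.
move=> s0; set p := s / d%:R; have p0 : 0 <= p by rewrite divr_ge0.
rewrite /weight_sum cube_sumE.
pose h (j : 'I_(2 * M).+1) := (1 + `|(j%:Z - M%:Z)|%N%:R : R) `^ (- p).
apply: (@le_trans _ _ (\sum_(g : {ffun 'I_d -> 'I_(2 * M).+1}) \prod_(i < d) h (g i))).
  apply: ler_sum => g _; set n := finfun _.
  have -> : - s = - p * d%:R by rewrite /p mulNr divfK ?gt_eqF.
  rewrite powRrM powR_mulrn ?powR_ge0//.
  rewrite -[X in _ ^+ X](card_ord d) -prodr_const; apply: ler_prod => i _.
  rewrite powR_ge0/= /h powRN_le ?lerD2l ?ltr_wpDr//.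
  by rewrite (le_trans _ (coord_le_norm n i nrmE))// ffunE natr_absz intr_norm.
rewrite -(bigA_distr_bigA (fun _ => h)) prodr_const card_ord.
apply: lerXn2r; rewrite ?nnegrE.
- by apply: sumr_ge0 => j _; exact: powR_ge0.
- by rewrite mulr_ge0// sumr_ge0// => j _; exact: powR_ge0.
- exact: (sum_segment_le (F := fun k => (1 + k%:R) `^ (- p))) => k; exact: powR_ge0.
Qed.

Lemma weight_sum_le_powR s : 0 <= s < d%:R ->
  exists2 C, 0 < C & forall M, weight_sum s M <= C * (2 * M + 1)%:R `^ (d%:R - s).
Proof.
move=> /andP[s0 sd]; have [|C C0 HC] := @sum_powRN_lt1 R (s / d%:R).
  by rewrite divr_ge0//= ltr_pdivrMr// mul1r.
exists ((2 * C) ^+ d) => [|M]; first by rewrite exprn_gt0// mulr_gt0.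
rewrite (le_trans (weight_sum_le_prod M s0))//.
have -> : d%:R - s = (1 - s / d%:R) * d%:R by rewrite mulrBl mul1r divfK ?gt_eqF.
rewrite powRrM powR_mulrn ?powR_ge0// -exprMn; apply: lerXn2r; rewrite ?nnegrE.
- by rewrite mulr_ge0// sumr_ge0// => j _; exact: powR_ge0.
- by rewrite !mulr_ge0 ?powR_ge0// ltW.
rewrite -mulrA ler_wpM2l// (le_trans (HC M))// ler_wpM2l// ?(ltW C0)//.
have M0 := ler0n R M.
rewrite ge0_ler_powR ?nnegrE ?subr_ge0 ?ler_pdivrMr ?mul1r ?(ltW sd)//.
by rewrite natrD natrM; lra.
Qed.

Lemma weight_sum_bounded s : d%:R < s -> exists2 C, 0 < C & forall M, weight_sum s M <= C.
Proof.
move=> ds; have [|C C0 HC] := @sum_powRN_gt1 R (s / d%:R).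
  by rewrite ltr_pdivlMr// mul1r.
exists ((2 * C) ^+ d) => [|M]; first by rewrite exprn_gt0// mulr_gt0.
rewrite (le_trans (weight_sum_le_prod M (ltW (lt_trans dR ds))))//.
apply: lerXn2r; rewrite ?nnegrE.
- by rewrite mulr_ge0// sumr_ge0// => j _; exact: powR_ge0.
- by rewrite mulr_ge0// ltW.
by rewrite ler_wpM2l.
Qed.

(** Apply the mean-value bound for [t^(-s)] with [l = 2L + 1]: the two arguments differ by at most
    [(d + 1) l], and both are at least a fixed multiple of [l (1 + |q|)]. *)
Lemma dilation_weight_dist s L q r : 0 <= s -> q != 0 -> r \in fset_set (cube L) ->
  `|(1 + nrm (q *+ (2 * L + 1) + r)) `^ (- s) - ((2 * L + 1)%:R * (1 + nrm q)) `^ (- s)|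
  <= s * (4 * d%:R) `^ (s + 1) * (d%:R + 1) *
     ((2 * L + 1)%:R `^ (- s) * (1 + nrm q) `^ (- (s + 1))).
Proof.
move=> s0 q0 rL; set l := (2 * L + 1)%:R; set x := nrm _.
have l1 : 1 <= l by rewrite /l ler1n addn1.
have l0 : 0 < l by lra.
have d1 : 1 <= d%:R :> R by rewrite ler1n.
have q1 : 1 <= nrm q.
  have [i qi] : exists i, q i != 0.
    apply/existsP; apply: contraNT q0 => /existsPn q0; apply/eqP/ffunP => i.
    by have := q0 i; rewrite negbK ffunE => /eqP.
  rewrite (le_trans _ (coord_le_norm q i nrmE))// -intr_norm -[1]/(1%:~R) ler_int.
  by lia.
(* The norm of the dilated point is at least [l |q| / (2d)], and [1 + |q| <= 2 |q|] because [q] is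
   nonzero. *)
pose m := l * (1 + nrm q) / (4 * d%:R).
have d4 : 0 < 4 * d%:R :> R by rewrite mulr_gt0.
have m0 : 0 < m by rewrite divr_gt0// mulr_gt0.
have mx : m <= 1 + x.
  have := dilation_norm_ge nrmE q rL; rewrite -/l -/x ler_pdivrMr// natrM => H.
  have : 0 <= d%:R * x by rewrite mulr_ge0// lattice_norm_ge0.
  have : l * 1 <= l * nrm q by rewrite ler_pM2l.
  lra.
have my : m <= l * (1 + nrm q).
  by rewrite ler_pdivrMr// ler_peMr ?mulr_ge0 ?ltW//; lra.
rewrite (le_trans (dist_powRN_le s0 m0 mx my))//.
have xy : `|1 + x - l * (1 + nrm q)| <= (d%:R + 1) * l.
  have := dilation_norm_sub_le nrmE q rL; rewrite -/l -/x => H.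
  have -> : 1 + x - l * (1 + nrm q) = (x - l * nrm q) + (1 - l) by ring.
  rewrite (le_trans (ler_normD _ _))// (le_trans (lerD H (lexx _)))//.
  rewrite ler0_norm; last lra.
  have Ll : (L <= 2 * L + 1)%N by rewrite mul2n -addnn -addnA leq_addr.
  have : d%:R * L%:R <= d%:R * l by rewrite ler_pM2l// ler_nat.
  lra.
rewrite (le_trans (ler_wpM2l _ xy)) ?mulr_ge0 ?powR_ge0//.
have -> : m `^ (- s - 1) = (4 * d%:R) `^ (s + 1) * (l `^ (- s) / l) * (1 + nrm q) `^ (- (s + 1)).
  rewrite /m powRM ?invr_ge0 ?mulr_ge0 ?ltW// powRM ?ltW//.
  rewrite -powR_inv1 ?(ltW d4)// -powRrM.
  rewrite (_ : -1 * (- s - 1) = s + 1); last by ring.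
  rewrite (_ : - (s + 1) = - s - 1); last by ring.
  rewrite -(@powR_inv1 _ l) ?(ltW l0)// -gt0_powRD//.
  by ring.
rewrite le_eqVlt; apply/orP; left; apply/eqP.
by field; rewrite gt_eqF.
Qed.

(** The block [q = 0] contributes exactly [W_L]. In any other block all [l^d] weights are replaced
    by [(l (1 + |q|))^(-s)], for a total of [l^(d-s) (1 + |q|)^(-s)], and the errors of
    [dilation_weight_dist] add up to the right-hand side. *)
Lemma weight_sum_dilation s : 0 <= s -> exists2 C, 0 <= C & forall L M,
  `|weight_sum s (2 * L * M + L + M) - weight_sum s L
    - (2 * L + 1)%:R `^ (d%:R - s) * (weight_sum s M - 1)|
  <= C * ((2 * L + 1)%:R `^ (d%:R - s) * weight_sum (s + 1) M).
Proof.
move=> s0; set C := s * (4 * d%:R) `^ (s + 1) * (d%:R + 1).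
have C0 : 0 <= C by rewrite !mulr_ge0 ?powR_ge0// addr_ge0// ltW.
exists C => // L M; set l := (2 * L + 1)%:R.
have l0 : 0 < l by rewrite ltr0n addn1.
have z0 : 0 \in fset_set (@cube d M).
  by apply/mem_cubeP => i; rewrite ffunE normr0.
have -> : weight_sum s (2 * L * M + L + M) - weight_sum s L =
    \sum_(q <- fset_set (cube M) | q != 0) \sum_(r <- fset_set (cube L))
      (1 + nrm (q *+ (2 * L + 1) + r)) `^ (- s).
  rewrite /weight_sum cube_sum_dilation (bigD1_seq _ z0) ?fset_uniq//=.
  apply/eqP; rewrite subr_eq addrC; apply/eqP; congr (_ + _).
  apply: eq_bigr => r _; congr ((1 + nrm _) `^ _); apply/ffunP => i.
  by rewrite ffunE ffunMnE ffunE mul0rn add0r.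
have -> : weight_sum s M - 1 = \sum_(q <- fset_set (cube M) | q != 0) (1 + nrm q) `^ (- s).
  rewrite /weight_sum (bigD1_seq _ z0) ?fset_uniq//=.
  by rewrite (lattice_norm0 nrmE) addr0 powR1 addrAC subrr add0r.
have E q : l `^ (d%:R - s) * (1 + nrm q) `^ (- s) =
    \sum_(r <- fset_set (@cube d L)) (l * (1 + nrm q)) `^ (- s).
  rewrite cube_sum_const -/l powRM ?(ltW l0) ?(ltW (nrm1_gt0 _))//.
  by rewrite -powR_mulrn ?(ltW l0)// gt0_powRD//; ring.
rewrite mulr_sumr -sumrB (le_trans (ler_norm_sum _ _ _))//.
rewrite [leRHS]mulrA /weight_sum mulr_sumr.
apply: (@le_trans _ _ (\sum_(q <- fset_set (cube M) | q != 0) 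
   C * l `^ (d%:R - s) * (1 + nrm q) `^ (- (s + 1)))); last first.
  rewrite [leRHS](bigID (fun q => q != 0))/= lerDl sumr_ge0// => q _.
  by rewrite !mulr_ge0 ?powR_ge0.
apply: ler_sum => q q0; rewrite E -sumrB (le_trans (ler_norm_sum _ _ _))//.
have -> : C * l `^ (d%:R - s) * (1 + nrm q) `^ (- (s + 1)) =
    \sum_(r <- fset_set (@cube d L)) C * (l `^ (- s) * (1 + nrm q) `^ (- (s + 1))).
  by rewrite cube_sum_const -/l gt0_powRD// powR_mulrn ?(ltW l0)//; ring.
rewrite big_seq [leRHS]big_seq; apply: ler_sum => r rL.
exact: dilation_weight_dist.
Qed.

End WeightSums.

(** * Convergence from cross bounds *)

Section CrossBounds.
Variable R : realType.

(** Every [u L - e L] is below every [u M + e M], so the supremum of the former lies within [e M] of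
    [u M]. The lower bound on the limit serves later to prove positivity. Index 0 is excluded
    because [ln (2L + 1)] vanishes there. *)
Lemma cvg_cross_bound (u e : nat -> R) :
  (forall L M, (0 < L)%N -> (0 < M)%N -> u L - e L <= u M + e M) ->
  e L @[L --> \oo] --> 0 ->
  exists l, u L @[L --> \oo] --> l /\ forall L, (0 < L)%N -> u L - e L <= l.
Proof.
move=> ue e0; pose A := [set u L - e L | L in [set L | (0 < L)%N]].
have A0 : A !=set0 by exists (u 1%N - e 1%N); exists 1%N.
have Aub M : (0 < M)%N -> ubound A (u M + e M) by move=> M0 _ [L L0 <-]; exact: ue.
have lb L : (0 < L)%N -> u L - e L <= sup A.
  by move=> L0; apply: ub_le_sup; [exists (u 1%N + e 1%N); exact: Aub|exists L].
have ub M : (0 < M)%N -> sup A <= u M + e M by move=> M0; apply: ge_sup => //; exact: Aub.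
exists (sup A); split=> //.
apply: (@squeeze_cvgr _ _ _ _ (fun L => sup A - e L) (fun L => sup A + e L)).
- near=> L; have L0 : (0 < L)%N by near: L; exists 1%N.
  by rewrite lerBlDr ub//= -lerBlDr lb.
- by rewrite -[X in _ --> X]subr0; apply: cvgB => //; exact: cvg_cst.
- by rewrite -[X in _ --> X]addr0; apply: cvgD => //; exact: cvg_cst.
Unshelve. all: by end_near. Qed.

Lemma ler0_of_natmul_le (x y : R) : (forall k : nat, k.+1%:R * x <= y) -> x <= 0.
Proof.
move=> H; rewrite leNgt; apply/negP => x0.
have y0 : 0 <= y by apply: le_trans (H 0%N); rewrite mul1r ltW.
have := H (Num.trunc (y / x)); rewrite leNgt => /negP; apply.
by rewrite -ltr_pdivrMr// truncnS_gt.
Qed.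

Let odd_gt1 L : (0 < L)%N -> 1 < (2 * L + 1)%:R :> R.
Proof. by move=> L0; rewrite ltr1n; lia. Qed.

Lemma cvg_ln_odd : ln (2 * L + 1)%:R @[L --> \oo] --> (+oo : set_system R).
Proof.
apply/cvgryPge => A; near=> L.
have L0 : 0 < (2 * L + 1)%:R :> R by rewrite ltr0n addn1.
have : expR A <= (2 * L + 1)%:R by near: L; move/cvgryPge : (@odd_cvgy R); exact.
by rewrite -ler_ln ?posrE ?expR_gt0// expRK.
Unshelve. all: by end_near. Qed.

(** * Monotone sequences quasi-additive under dilation *)

Section QuasiAdditive.
Variables (w : nat -> R) (C : R).
Hypothesis w_homo : {homo w : L M / (L <= M)%N >-> L <= M}.
Hypothesis w_add : forall L M, `|w (2 * L * M + L + M)%N - w L - w M| <= C.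

Let pw L k := iter k (fun M => 2 * L * M + L + M)%N L.

Let pwE L k : (2 * pw L k + 1 = (2 * L + 1) ^ k.+1)%N.
Proof.
elim: k => [|k IH]; first by rewrite expn1.
by rewrite expnS -IH /pw iterS; lia.
Qed.

(** Each dilation by [2L + 1] adds [w L] up to an error [C]. *)
Let w_pw L k : `|w (pw L k) - k.+1%:R * w L| <= k.+1%:R * C.
Proof.
have C0 : 0 <= C by apply: le_trans (w_add 0 0).
elim: k => [|k IH]; first by rewrite !mul1r subrr normr0.
rewrite /pw iterS -/(pw L k) -[k.+2]addn1 natrD !mulrDl !mul1r.
have -> : w (2 * L * pw L k + L + pw L k)%N - (k.+1%:R * w L + w L) =
  (w (2 * L * pw L k + L + pw L k)%N - w L - w (pw L k)) + (w (pw L k) - k.+1%:R * w L).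
  by ring.
by rewrite (le_trans (ler_normD _ _))// addrC lerD.
Qed.

(** Compare the powers [(2L + 1)^(k+1)] and [(2M + 1)^(j+1)] for the first [j] making the second at
    least as large. Monotonicity gives [(k+1)(w L - C) <= (j+1)(w M + C)], where [j + 1] is
    [(k+1) l / m] up to 1; then let [k] grow. *)
Let w_cross L M : (0 < L)%N -> (0 < M)%N ->
  (w L - C) / ln (2 * L + 1)%:R <= (w M + C) / ln (2 * M + 1)%:R.
Proof.
move=> L0 M0; set l : R := ln _; set m : R := ln _.
have l0 : 0 < l by rewrite ln_gt0// odd_gt1.
have m0 : 0 < m by rewrite ln_gt0// odd_gt1.
rewrite ler_pdivrMr// mulrAC -mulrA -subr_le0.
apply: (@ler0_of_natmul_le _ `|w M + C|) => k.
pose j := Num.trunc (k.+1%:R * l / m).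
have x0 : 0 <= k.+1%:R * l / m by rewrite divr_ge0 ?mulr_ge0// ltW.
have /andP[jl jg] := truncn_itv x0.
have H : w (pw L k) <= w (pw M j).
  apply: w_homo; suff : (2 * pw L k + 1 <= 2 * pw M j + 1)%N by lia.
  have L1 : 0 < (2 * L + 1)%:R :> R by rewrite (lt_trans ltr01) ?odd_gt1.
  have M1 : 0 < (2 * M + 1)%:R :> R by rewrite (lt_trans ltr01) ?odd_gt1.
  rewrite !pwE -(ler_nat R) !natrX -ler_ln ?posrE ?exprn_gt0//.
  rewrite !lnXn// -/l -/m -[l *+ _]mulr_natl -[m *+ _]mulr_natl.
  by rewrite -ler_pdivrMr// ltW.
have := w_pw L k; rewrite ler_norml => /andP[H1 _].
have := w_pw M j; rewrite ler_norml => /andP[_ H2].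
have H3 : k.+1%:R * (w L - C) <= j.+1%:R * (w M + C) by lra.
(* If [w M + C] is nonnegative, use [j <= (k+1) l / m]; if it is negative, use
   [(k+1) l / m < j + 1]. *)
have H4 : j.+1%:R * (w M + C) <= k.+1%:R * l / m * (w M + C) + `|w M + C|.
  have -> : k.+1%:R * l / m * (w M + C) + `|w M + C| =
      k.+1%:R * l / m * (w M + C) + 1 * `|w M + C| by rewrite mul1r.
  have [N|N] := leP 0 (w M + C).
    rewrite (ger0_norm N) -mulrDl ler_wpM2r// -natr1 lerD2r//.
  rewrite (@le_trans _ _ (k.+1%:R * l / m * (w M + C)))//.
    by rewrite ler_wnM2r// ltW.
  by rewrite lerDl mulr_ge0.
rewrite mulrBr (_ : k.+1%:R * ((w M + C) * (l / m)) = k.+1%:R * l / m * (w M + C)); last by ring.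
by lra.
Qed.

Lemma quasi_additive_cvg : exists l, w L / ln (2 * L + 1)%:R @[L --> \oo] --> l /\
  forall L, (0 < L)%N -> (w L - C) / ln (2 * L + 1)%:R <= l.
Proof.
have [L M L0 M0||l [ul bl]] := @cvg_cross_bound (fun L => w L / ln (2 * L + 1)%:R)
    (fun L => C / ln (2 * L + 1)%:R).
- by rewrite -mulrBl -mulrDl; exact: w_cross.
- rewrite -[X in _ --> X](mulr0 C); apply: cvgM; first exact: cvg_cst.
  apply/(@gtr0_cvgV0 _ _ _ _ (fun L => ln (2 * L + 1)%:R)); last exact: cvg_ln_odd.
  by near=> L; rewrite ln_gt0// odd_gt1//; near: L; exists 1%N.
exists l; split=> // L L0; rewrite mulrBl; exact: bl.
Unshelve. all: by end_near. Qed.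

End QuasiAdditive.
End CrossBounds.

(** * Existence and positivity of the limit b *)

Section WeightSumLimit.
Variables (R : realType) (d : nat) (nrm : lattice d -> R).
Hypothesis nrmE : nrm = @l1_norm R d \/ nrm = @l2_norm R d.
Hypothesis d_gt0 : (0 < d)%N.
Implicit Types (n : lattice d) (s : R) (L M : nat).

Let W := weight_sum nrm.
Let dR : (0 : R) < d%:R. Proof. by rewrite ltr0n. Qed.
Let nrm1 n : 1 <= 1 + nrm n. Proof. by rewrite lerDl lattice_norm_ge0. Qed.
Let nrm1_gt0 n : 0 < 1 + nrm n. Proof. by rewrite (lt_le_trans ltr01). Qed.
Let odd_gt0 L : 0 < (2 * L + 1)%:R :> R. Proof. by rewrite ltr0n addn1. Qed.

Lemma weight_ge s L n : 0 <= s -> n \in fset_set (cube L) ->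
  (d%:R * (2 * L + 1)%:R) `^ (- s) <= (1 + nrm n) `^ (- s).
Proof.
move=> s0 nL; apply: powRN_le => //.
have := le_trans (lattice_norm_le_l1 nrmE n) (l1_norm_cube_le R nL).
have d1 : 1 <= d%:R :> R by rewrite ler1n.
have : 0 <= d%:R * L%:R :> R by rewrite mulr_ge0.
by rewrite natrD natrM; lra.
Qed.

(** Each of the [(2L + 1)^d] weights is at least [(d (2L + 1))^(-s)]. This keeps the limit positive
    when [s < d]. *)
Lemma weight_sum_ge s L : 0 <= s -> d%:R `^ (- s) * (2 * L + 1)%:R `^ (d%:R - s) <= W s L.
Proof.
move=> s0; rewrite gt0_powRD// powR_mulrn ?(ltW (odd_gt0 L))// mulrCA.
rewrite -powRM ?(ltW (odd_gt0 L)) ?(ltW dR)// mulrC -cube_sum_const.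
by rewrite /W /weight_sum big_seq [leRHS]big_seq; apply: ler_sum => n nL; exact: weight_ge.
Qed.

Lemma weight_sum_anti s t M : s <= t -> W t M <= W s M.
Proof.
by move=> st; apply: ler_sum => n _; rewrite ler_powR ?lerN2.
Qed.

Lemma weight_sum_cvg_lt s : 0 <= s < d%:R ->
  exists2 b : R, 0 < b & W s L / (2 * L + 1)%:R `^ (d%:R - s) @[L --> \oo] --> b.
Proof.
move=> /andP[s0 sd]; set c := d%:R - s; have c0 : 0 < c by rewrite subr_gt0.
have [B B0 WB] := weight_sum_le_powR nrmE d_gt0 (introT andP (conj s0 sd)).
(* The exponent [s + 1] of the error sum may reach or exceed [d]. Lowering it to [s + eta < d] still
   gives an error of order [m^(c - eta)], negligible against [m^c]. *)
pose eta := Num.min 1 (c / 2).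
have eta0 : 0 < eta by rewrite lt_min ltr01 divr_gt0.
have seta : 0 <= s + eta < d%:R.
  rewrite addr_ge0 ?(ltW eta0)//=.
  have : eta <= c / 2 by rewrite ge_min lexx orbT.
  by rewrite /c in c0 *; lra.
have [B' B'0 WB'] := weight_sum_le_powR nrmE d_gt0 seta.
have [C C0 HC] := weight_sum_dilation nrmE d_gt0 s0.
pose e M : R := (B + 1) * (2 * M + 1)%:R `^ (- c) + C * B' * (2 * M + 1)%:R `^ (- eta).
pose u L := W s L / (2 * L + 1)%:R `^ c.
(* The bound depends on [M] alone. As [2LM + L + M] is symmetric in [L] and [M], exchanging them
   yields [u L - e L <= u K <= u M + e M]. *)
have close L M : `|u (2 * L * M + L + M)%N - u M| <= e M.
  set l : R := (2 * L + 1)%:R; set m : R := (2 * M + 1)%:R.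
  have l0 : 0 < l := odd_gt0 L; have m0 : 0 < m := odd_gt0 M.
  have lc : 0 < l `^ c by rewrite powR_gt0.
  have mc : 0 < m `^ c by rewrite powR_gt0.
  have -> : u (2 * L * M + L + M)%N - u M =
    ((W s (2 * L * M + L + M) - W s L - l `^ c * (W s M - 1)) + (W s L - l `^ c))
      / (l `^ c * m `^ c).
    rewrite /u -/m (_ : (2 * (2 * L * M + L + M) + 1)%:R = l * m); last first.
      by rewrite -natrM dilation_size.
    rewrite powRM ?(ltW l0) ?(ltW m0)//.
    by field; rewrite !gt_eqF.
  rewrite normrM normfV [X in _ / X]gtr0_norm ?mulr_gt0// ler_pdivrMr ?mulr_gt0//.
  rewrite (le_trans (ler_normD _ _))// (le_trans (lerD (HC L M) (ler_normB _ _)))//.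
  rewrite -/l -/c (gtr0_norm lc) ger0_norm ?weight_sum_ge0//.
  have -> : e M * (l `^ c * m `^ c) = C * (l `^ c * (B' * m `^ (c - eta))) + (B * l `^ c + l `^ c).
    rewrite /e -/m (gt0_powRD c (- eta))// (powRN _ c).
    by field; rewrite ?gt_eqF.
  rewrite lerD ?lerD2r ?WB// ler_wpM2l// ler_pM2l//.
  rewrite (_ : c - eta = d%:R - (s + eta)); last by rewrite /c; ring.
  rewrite (le_trans _ (WB' M))// weight_sum_anti// lerD2l.
  by rewrite ge_min lexx.
have [L M L0 M0||b [ub _]] := @cvg_cross_bound _ u e.
- have := close L M; rewrite ler_norml => /andP[_].
  have := close M L; rewrite (_ : 2 * M * L + M + L = 2 * L * M + L + M)%N; last by rewrite mulnAC addnAC.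
  rewrite ler_norml => /andP[H _]; move: H.
  by lra.
- rewrite -[X in _ --> X]addr0; apply: cvgD.
    rewrite -[X in _ --> X](mulr0 (B + 1)); apply: cvgM; first exact: cvg_cst.
    exact: odd_powR_cvg0.
  rewrite -[X in _ --> X](mulr0 (C * B')); apply: cvgM; first exact: cvg_cst.
  exact: odd_powR_cvg0.
exists b => //; apply: (@lt_le_trans _ _ (d%:R `^ (- s))); first exact: powR_gt0.
apply: (ler_cvg_to (cvg_cst _) ub); apply: nearW => L.
by rewrite /u ler_pdivlMr ?powR_gt0// weight_sum_ge.
Qed.

(** Passing from [L] to [3L + 1] triples the side [l]. The shell holds [(3^d - 1) l^d] points of
    weight at least [(3 d l)^(-d)], hence adds at least [c = d^(-d) / 2], whatever [L]. *)
Lemma weight_sum_unbounded (A : R) : exists2 L, (0 < L)%N & A < W d%:R L.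
Proof.
pose c : R := d%:R `^ (- d%:R) / 2.
have c0 : 0 < c by rewrite divr_gt0// powR_gt0.
have step L : W d%:R L + c <= W d%:R (3 * L + 1).
  have LK : (L <= 3 * L + 1)%N by lia.
  rewrite -lerBrDl /W /weight_sum cube_sumB//.
  set l : R := (2 * L + 1)%:R.
  have El : (2 * (3 * L + 1) + 1)%:R = 3 * l :> R by rewrite -natrM; congr (_%:R); clear; lia.
  have l0 : 0 < l := odd_gt0 L.
  apply: (@le_trans _ _ (\sum_(n <- fset_set (cube (3 * L + 1)) | n \notin fset_set (@cube d L))
      (d%:R * (3 * l)) `^ (- d%:R))); last first.
    rewrite big_seq_cond [leRHS]big_seq_cond; apply: ler_sum => n /andP[nK _].
    by rewrite -El weight_ge.
  rewrite -cube_sumB// !cube_sum_const El -/l -mulrBr.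
  rewrite powRM ?(ltW dR) ?mulr_ge0 ?(ltW l0)// /c -!mulrA ler_pM2l ?powR_gt0//.
  rewrite powRN powR_mulrn ?mulr_ge0 ?(ltW l0)// ler_pdivlMl ?exprn_gt0 ?mulr_gt0//.
  rewrite !exprMn; have : 3 * l ^+ d <= 3 ^+ d * l ^+ d.
    rewrite ler_pM2r ?exprn_gt0// -[X in X <= _]expr1 ler_weXn2l ?ler1n//.
  have : 0 < l ^+ d by rewrite exprn_gt0.
  by lra.
pose f k := iter k (fun L => 3 * L + 1)%N 1%N.
have fk k : k%:R * c <= W d%:R (f k).
  elim: k => [|k IH]; first by rewrite mul0r weight_sum_ge0.
  rewrite /f iterS -/(f k) (le_trans _ (step _))// -natr1 mulrDl mul1r.
  by rewrite lerD2r.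
exists (f (Num.trunc (A / c)).+1).
  by rewrite /f iterS addn1.
by rewrite (lt_le_trans _ (fk _))// -ltr_pdivrMr// truncnS_gt.
Qed.

(** At [s = d] the factor [l^(d-s)] is 1 and [W] at exponent [d + 1] is bounded by [B], so [W] is
    quasi-additive with constant [C B + 1]. Since [W] is unbounded, it exceeds this constant at some
    [L], which makes the limit positive. *)
Lemma weight_sum_cvg_eq :
  exists2 b : R, 0 < b & W d%:R L / ln (2 * L + 1)%:R @[L --> \oo] --> b.
Proof.
have [C C0 HC] := weight_sum_dilation nrmE d_gt0 (ltW dR).
have d1 : d%:R < d%:R + 1 :> R by rewrite ltrDl.
have [B B0 HB] := weight_sum_bounded nrmE d_gt0 d1.
have w_add L M : `|W d%:R (2 * L * M + L + M) - W d%:R L - W d%:R M| <= C * B + 1.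
  have := HC L M; rewrite subrr powRr0 !mul1r => H.
  have -> : W d%:R (2 * L * M + L + M) - W d%:R L - W d%:R M =
    (W d%:R (2 * L * M + L + M) - W d%:R L - (W d%:R M - 1)) - 1 by ring.
  rewrite (le_trans (ler_normB _ _))// normr1 lerD2r (le_trans H)//.
  by rewrite ler_wpM2l// HB.
have w_homo : {homo W d%:R : L M / (L <= M)%N >-> L <= M}.
  by move=> L M LM; apply: cube_sum_le_mono => // n; exact: powR_ge0.
have [b [ub bge]] := quasi_additive_cvg w_homo w_add.
have [L L0 HL] := weight_sum_unbounded (C * B + 1).
exists b => //; apply: lt_le_trans (bge L L0).
by rewrite divr_gt0 ?subr_gt0// ln_gt0// ltr1n; lia.
Qed.

Section GammaLimit.
Variables alpha delta : R.
Hypotheses (alpha_gt0 : 0 < alpha) (delta_gt0 : 0 < delta).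
Hypothesis alphadelta_le : alpha * delta <= d%:R.

Let ad0 : 0 <= alpha * delta. Proof. by rewrite mulr_ge0// ltW. Qed.

Lemma Gamma_powR L : Gamma d alpha delta L `^ delta =
  if alpha * delta < d%:R then (2 * L + 1)%:R `^ (d%:R - alpha * delta)
  else ln (2 * L + 1)%:R.
Proof.
rewrite /Gamma; case: ifP => _; rewrite -powRrM.
  by rewrite divfK// gt_eqF.
by rewrite mulVf ?gt_eqF// powRr1// ln_ge0// ler1n addn1.
Qed.

Lemma normalized_weight_sumE L : normalized_weight_sum nrm alpha delta L =
  (Gamma d alpha delta L `^ delta)^-1 * W (alpha * delta) L.
Proof.
rewrite /normalized_weight_sum fsbig_finite; last exact: finite_cube.
by congr (_ * _); apply: eq_bigr => n _; rewrite powRN.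
Qed.

Lemma normalized_weight_sum_cvg : exists2 b : R, 0 < b &
  normalized_weight_sum nrm alpha delta L @[L --> \oo] --> b.
Proof.
have [adlt|adge] := ltP (alpha * delta) d%:R.
  have [b b0 hb] := weight_sum_cvg_lt (introT andP (conj ad0 adlt)).
  exists b => //; apply: cvg_trans hb; apply: near_eq_cvg; apply: nearW => L.
  by rewrite normalized_weight_sumE Gamma_powR adlt mulrC.
have E : alpha * delta = d%:R by apply: le_anti; rewrite alphadelta_le adge.
have [b b0 hb] := weight_sum_cvg_eq.
exists b => //; apply: cvg_trans hb; apply: near_eq_cvg; apply: nearW => L.
by rewrite normalized_weight_sumE Gamma_powR E ltxx mulrC.
Qed.

Lemma Gamma_powR_cvgy : Gamma d alpha delta L `^ delta @[L --> \oo] --> +oo.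
Proof.
rewrite (funext Gamma_powR).
case: (boolP (alpha * delta < d%:R)) => [adlt|_]; last exact: cvg_ln_odd.
have c0 : 0 < d%:R - alpha * delta by rewrite subr_gt0.
apply/(@gtr0_cvgV0 _ _ _ _ (fun L => (2 * L + 1)%:R `^ (d%:R - alpha * delta))).
  by apply: nearW => L; rewrite powR_gt0.
apply: cvg_trans (odd_powR_cvg0 c0); apply: near_eq_cvg; apply: nearW => L.
by rewrite powRN.
Qed.

Lemma Gamma_cvgy : Gamma d alpha delta L @[L --> \oo] --> +oo.
Proof.
apply/cvgryPge => A; near=> L.
have H : `|A| `^ delta <= Gamma d alpha delta L `^ delta.
  by near: L; move/cvgryPge : Gamma_powR_cvgy; exact.
rewrite (le_trans (ler_norm A))// leNgt; apply/negP => GA.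
have G0 : 0 <= Gamma d alpha delta L by rewrite /Gamma; case: ifP => _; exact: powR_ge0.
move: H; rewrite leNgt => /negP; apply.
by apply: gt0_ltr_powR; rewrite ?nnegrE.
Unshelve. all: by end_near. Qed.

End GammaLimit.
End WeightSumLimit.

(** * Tails of the Pareto law *)

Section ParetoTail.
Import measurable_realfun.
Variables (R : realType) (delta : R).
Hypothesis delta_gt0 : 0 < delta.
Local Notation mu := (@lebesgue_measure R).

(** [g] continues the density on [x > 1] to all [x > 0]; [F] is its antiderivative vanishing at
    infinity. *)
Let g (x : R) : R := delta / 2 * x `^ (- delta - 1).
Let F (x : R) : R := - 2^-1 * x `^ (- delta).

Let g_ge0 x : 0 <= g x.
Proof. by rewrite mulr_ge0 ?powR_ge0// divr_ge0// ltW. Qed.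

Let is_deriveF (x : R) : 0 < x -> is_derive x 1 F (g x).
Proof.
move=> x0; have := is_derive1_powR (- delta) x0 => H.
have -> : g x = - 2^-1 *: (- delta * x `^ (- delta - 1)).
  by rewrite /g /GRing.scale /=; field.
exact: (@is_deriveZ _ _ _ (fun y : R => y `^ (- delta)) (- 2^-1) x 1 _ H).
Qed.

Let g_derivable (x : R) : 0 < x -> derivable g x 1.
Proof.
move=> x0; have H := is_derive1_powR (- delta - 1) x0.
by have [] := @is_deriveZ _ _ _ (fun y : R => y `^ (- delta - 1)) (delta / 2) x 1 _ H.
Qed.

Let pareto_gt (x : R) : 1 < `|x| -> pareto_density delta x = g `|x|.
Proof.
move=> x1; have x0 : 0 < `|x| := lt_trans ltr01 x1.
by rewrite /pareto_density x1 /g -opprD powRN [1 + _]addrC.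
Qed.

Let integral_g t : 1 <= t -> (\int[mu]_(x in `[t, +oo[) (g x)%:E = (t `^ (- delta) / 2)%:E)%E.
Proof.
move=> t1; have t0 : 0 < t := lt_le_trans ltr01 t1.
rewrite (@ge0_continuous_FTC2y _ g F t 0)//.
- by rewrite sub0e -EFinN /F; congr (_%:E); lra.
- apply: derivable_within_continuous => x; rewrite in_itv/= andbT => tx.
  by apply: g_derivable; exact: lt_le_trans tx.
- rewrite /F -[X in _ --> X](mulr0 (- 2^-1)); apply: cvgM; first exact: cvg_cst.
  by apply: powRN_cvg0 => //; exact: cvg_id.
- by move=> x tx; have [] := is_deriveF (lt_trans t0 tx).
- apply: cvg_at_right_filter; apply/differentiable_continuous/derivable1_diffP.
  by have [] := is_deriveF t0.
- move=> x; rewrite in_itv/= andbT => tx.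
  by rewrite derive1E; have [_ ->] := is_deriveF (lt_trans t0 tx).
Qed.

Let measurable_g (D : set R) : measurable_fun D (fun x => (g x)%:E).
Proof.
apply/measurable_EFinP; apply: measurable_funTS; exact: measurable_funM.
Qed.

Lemma pareto_right_tail t : 1 <= t ->
  (\int[mu]_(x in `]t, +oo[) (pareto_density delta x)%:E = (t `^ (- delta) / 2)%:E)%E.
Proof.
move=> t1; rewrite -integral_g// -integral_itv_obnd_cbnd; last exact: measurable_g.
apply: eq_integral => x; rewrite inE/= in_itv/= andbT => tx.
have x1 := le_lt_trans t1 tx; have x0 := lt_trans ltr01 x1.
by rewrite pareto_gt gtr0_norm.
Qed.

Lemma pareto_left_tail (t : R) : 1 <= t ->
  (\int[mu]_(x in `]-oo, (- t)%R[) (pareto_density delta x)%:E = (t `^ (- delta) / 2)%:E)%E.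
Proof.
move=> t1; have t0 : 0 < t := lt_le_trans ltr01 t1.
pose G x := g (- x).
transitivity (\int[mu]_(x in `]-oo, (- t)%R]) (G x)%:E)%E.
  rewrite -integral_itv_bndo_bndc; last first.
    apply: (measurableT_comp (measurable_g (D := setT))) => //.
  apply: eq_integral => x; rewrite inE/= in_itv/= => xt.
  have x0 : x < 0 by rewrite (lt_trans xt)// oppr_lt0.
  by rewrite pareto_gt ltr0_norm// (le_lt_trans t1)// ltrNr.
rewrite ge0_integration_by_substitutionNy//.
- rewrite -integral_g//; apply: eq_integral => x _ /=.
  by rewrite /G opprK.
- apply: derivable_within_continuous => x; rewrite in_itv/= => xt.
  have x0 : 0 < - x by rewrite oppr_gt0 (le_lt_trans xt)// oppr_lt0.
  apply/derivable1_diffP; apply: differentiable_comp; first exact: differentiableN.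
  exact/derivable1_diffP/g_derivable.
- by move=> x _; exact: g_ge0.
Qed.

Variables (disp : measure_display) (Omega : measurableType disp) (P : probability Omega R).

(** Both tails beyond [t >= 1] have mass [t^(-delta) / 2]. The sign lets one argument serve the top
    of the spectrum of [H] and that of [-H]. *)
Lemma pareto_signed_cdf (X : {RV P >-> R}) (sgn t : R) :
  has_density X (pareto_density delta) -> sgn = 1 \/ sgn = -1 -> 1 <= t ->
  P [set w | sgn * X w <= t] = (1 - t `^ (- delta) / 2)%:E.
Proof.
move=> Xd sgnE t1; pose A := [set x : R | t < sgn * x].
have mA : measurable A.
  case: sgnE; rewrite /A => ->.
    rewrite (_ : [set _ | _] = `]t, +oo[%classic)//.
    by apply/seteqP; split => x /=; rewrite in_itv/= mul1r andbT.
  rewrite (_ : [set _ | _] = `]-oo, - t[%classic)//.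
  by apply/seteqP; split => x /=; rewrite in_itv/= mulN1r ltrNr.
have -> : [set w | sgn * X w <= t] = ~` (X @^-1` A).
  by apply/seteqP; split => w; rewrite /A /= leNgt => /negP.
rewrite probability_setC; last exact: measurable_funPTI.
suff -> : P (X @^-1` A) = (t `^ (- delta) / 2)%:E by rewrite -EFinB.
rewrite -[LHS]/(distribution P X A) Xd// /A.
case: sgnE => ->.
  rewrite (_ : [set _ | _] = `]t, +oo[%classic) ?pareto_right_tail//.
  by apply/seteqP; split => x /=; rewrite in_itv/= mul1r andbT.
rewrite (_ : [set _ | _] = `]-oo, - t[%classic) ?pareto_left_tail//.
by apply/seteqP; split => x /=; rewrite in_itv/= mulN1r ltrNr.
Qed.

End ParetoTail.

(** * Diagonal bounds for the box Hamiltonian *)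

Section BoxHamiltonian.
Variables (R : realType) (d : nat) (nrm : lattice d -> R) (alpha : R).
Hypothesis nrmE : nrm = @l1_norm R d \/ nrm = @l2_norm R d.
Implicit Types (n k : lattice d) (L : nat).
Local Notation site L i := (val (enum_val (A := {: fset_set (@cube d L)}) i)).

Let nrm1_gt0 n : 0 < 1 + nrm n.
Proof. by rewrite ltr_pwDl// lattice_norm_ge0. Qed.

Lemma laplacian_basis_vector n k :
  laplacian nrm (basis_vector R k) n = (nrm (k - n) == 1)%:R.
Proof.
have fin : finite_set [set j | nrm (j - n) = 1] by exact: finite_neighbours.
rewrite /laplacian fsbig_finite//.
have [kn|kn] := boolP (nrm (k - n) == 1).
  have kS : k \in fset_set [set j | nrm (j - n) = 1].
    by rewrite in_fset_set// inE; exact/eqP.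
  rewrite (bigD1_seq k kS) ?fset_uniq//= {1}/basis_vector eqxx big1 ?addr0// => j /negPf jk.
  rewrite /basis_vector.
  by rewrite jk.
rewrite big_seq big1// => j; rewrite in_fset_set// inE /= => jn.
by rewrite /basis_vector; case: eqP => // jk; rewrite -jk jn eqxx in kn.
Qed.

Lemma box_hamiltonianE w L i j : box_hamiltonian nrm alpha w L i j =
  (nrm (site L j - site L i) == 1)%:R +
  w (site L i) / (1 + nrm (site L i)) `^ alpha * (i == j)%:R.
Proof.
rewrite !mxE laplacian_basis_vector /potential /basis_vector.
by rewrite (inj_eq val_inj) (inj_eq enum_val_inj).
Qed.

Lemma box_hamiltonian_diag w L i : box_hamiltonian nrm alpha w L i i =
  w (site L i) / (1 + nrm (site L i)) `^ alpha.
Proof.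
rewrite box_hamiltonianE subrr eqxx mulr1.
by rewrite (lattice_norm0 nrmE) eq_sym oner_eq0 add0r.
Qed.

(** Off-diagonal entries are 0 or 1, and translation by the site of [i] injects its neighbours into
    the unit cube; the resulting bound [3^d] is crude but independent of [L]. *)
Lemma box_hamiltonian_offdiag w L i :
  \sum_(j | j != i) `|box_hamiltonian nrm alpha w L i j| <= #|` fset_set (@cube d 1)|%:R.
Proof.
pose near1 j := nrm (site L j - site L i) == 1.
apply: (@le_trans _ _ (\sum_(j | near1 j) 1)).
  rewrite [leLHS]big_mkcond [leRHS]big_mkcond; apply: ler_sum => j _.
  rewrite box_hamiltonianE eq_sym /near1; case: eqP => _ /=.
    by case: ifP.
  by rewrite mulr0 addr0; case: eqP; rewrite ?normr1 ?normr0.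
rewrite sumr_const ler_nat cardE.
rewrite -(size_map (fun j => site L j - site L i)); apply: uniq_leq_size.
  rewrite map_inj_in_uniq ?enum_uniq// => j k _ _ /addIr.
  by move=> /val_inj/enum_val_inj.
move=> m /mapP[j]; rewrite mem_enum => /eqP jn ->; apply/mem_cubeP => a.
by rewrite -(ler_int R) intr_norm (le_trans (coord_le_norm _ a nrmE))// jn.
Qed.

Section Signed.
Variables (sgn : R) (w : lattice d -> R) (L : nat).
Hypothesis sgnE : sgn = 1 \/ sgn = -1.
Let K := sgn *: box_hamiltonian nrm alpha w L.

Let K_sym : K^T = K.
Proof. by rewrite /K linearZ /= box_hamiltonian_sym. Qed.

Lemma max_spectrum_box_ge (T : R) : max_spectrum K <= T ->
  forall n, n \in fset_set (cube L) -> sgn * w n <= T * (1 + nrm n) `^ alpha.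
Proof.
move=> KT n nL; pose i := enum_rank ([` nL])%fset.
have Ei : site L i = n by rewrite enum_rankK.
have := le_trans (diag_le_max_spectrum i K_sym) KT.
by rewrite mxE box_hamiltonian_diag Ei mulrA ler_pdivrMr ?powR_gt0.
Qed.

Lemma max_spectrum_box_le (T : R) :
  (forall n, n \in fset_set (cube L) -> sgn * w n <= T * (1 + nrm n) `^ alpha) ->
  max_spectrum K <= T + #|` fset_set (@cube d 1)|%:R.
Proof.
move=> wT; apply: max_spectrum_le_gershgorin; rewrite ?box_size_gt0// => i.
  rewrite mxE box_hamiltonian_diag mulrA ler_pdivrMr ?powR_gt0// wT//.
  exact: valP.
rewrite (le_trans _ (box_hamiltonian_offdiag w i))//; apply: ler_sum => j _.
rewrite mxE normrM (_ : `|sgn| = 1) ?mul1r//.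
by case: sgnE => ->; rewrite ?normrN normr1.
Qed.

End Signed.
End BoxHamiltonian.

(** * Limit law of the largest eigenvalue *)

(** The lower bound comes from [ln (1 - z) >= 1 - 1 / (1 - z) = - z / (1 - z)]. A bound [eta]
    uniform in [z] turns a product of factors [1 - z] into the exponential of a sum. *)
Lemma expRN_le_1B (R : realType) (z eta : R) : 0 <= z -> z <= eta -> eta < 1 ->
  expR (- (z / (1 - eta))) <= 1 - z <= expR (- z).
Proof.
move=> z0 ze e1; have z1 : 0 < 1 - z by rewrite subr_gt0 (le_lt_trans ze).
apply/andP; split; last by rewrite (le_trans _ (expR_ge1Dx _)).
have H : 1 - (1 - z)^-1 <= ln (1 - z) by exact: ln_ge_1Binv.
rewrite -[leRHS]lnK ?posrE// ler_expR (le_trans _ H)//.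
have -> : 1 - (1 - z)^-1 = - (z / (1 - z)) by field; rewrite gt_eqF.
have e0 : 0 < 1 - eta by rewrite subr_gt0.
by rewrite lerN2 ler_wpM2l// lef_pV2 ?posrE// lerD2l lerN2.
Qed.

Lemma cvg_powR (R : realType) (a y : R) (f : nat -> R) : 0 < y ->
  f L @[L --> \oo] --> y -> f L `^ a @[L --> \oo] --> y `^ a.
Proof.
move=> y0 fy; have c : {for y, continuous (fun u : R => u `^ a)}.
  apply: differentiable_continuous; apply/derivable1_diffP.
  by have [] := is_derive1_powR a y0.
exact: (continuous_cvg _ c fy).
Qed.

(** * Measurability of spectral events *)

Section RandomSpectrum.
Import measurable_realfun.
Variables (R : realType) (disp : measure_display) (Omega : measurableType disp).

Section RandomMatrix.
Variables (N : nat) (K : Omega -> 'M[R]_N).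
Hypotheses (N0 : (0 < N)%N) (K_sym : forall w, (K w)^T = K w)
  (mK : forall i j, measurable_fun setT (fun w => K w i j)).

(** By [max_spectrum_leP] the complement is a countable union, over integer vectors, of events on
    linear combinations of the entries. *)
Lemma random_max_spectrum_le_measurable (T : R) : measurable [set w | max_spectrum (K w) <= T].
Proof.
pose Q (v : 'rV[int]_N) w := \sum_i \sum_j (v 0 i)%:~R * K w i j * (v 0 j)%:~R.
have mQ v : measurable_fun setT (Q v).
  apply: measurable_sum => i; apply: measurable_sum => j.
  by apply: measurable_funM => //; apply: measurable_funM.
rewrite -[X in measurable X]setCK; apply: measurableC.
rewrite (_ : ~` _ = \bigcup_(v in [set: 'rV[int]_N])
    [set w | T * (\sum_i (v 0 i)%:~R ^+ 2) < Q v w]).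
  apply: countable_bigcupT_measurable => [|v]; first exact: countableP.
  rewrite (_ : [set w | _] = Q v @^-1` `]T * (\sum_i (v 0 i)%:~R ^+ 2), +oo[%classic).
    by rewrite -[X in measurable X]setTI; apply: mQ.
  by apply/seteqP; split => w /=; rewrite in_itv/= andbT.
apply/seteqP; split => w /=.
  move=> /(contra_not (max_spectrum_leP T N0 (K_sym w)).2)/existsNP[v /negP].
  by rewrite -ltNge => Hv; exists v.
move=> [v _ Hv] /(max_spectrum_leP T N0 (K_sym w))/(_ v).
by rewrite leNgt Hv.
Qed.

Lemma random_max_spectrum_lt_measurable (T : R) : measurable [set w | max_spectrum (K w) < T].
Proof.
rewrite (_ : [set w | _] = \bigcup_k [set w | max_spectrum (K w) <= T - k.+1%:R^-1]).
  by apply: bigcupT_measurable => k; exact: random_max_spectrum_le_measurable.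
apply/seteqP; split => w /=.
  move=> /[dup] MT; rewrite -subr_gt0 => MT0.
  exists (Num.trunc (T - max_spectrum (K w))^-1) => //=.
  rewrite lerBrDl -lerBrDr -[leRHS]invrK lef_pV2 ?posrE ?ltr0n ?invr_gt0//.
  by rewrite ltW// truncnS_gt.
by move=> [k _ /= /le_lt_trans]; apply; rewrite ltrBlDr ltrDl invr_gt0.
Qed.

End RandomMatrix.

Lemma measurable_signed_hamiltonian (d L : nat) (nrm : lattice d -> R) (alpha sgn : R)
    (omega : lattice d -> {mfun Omega >-> R}) i j :
  nrm = @l1_norm R d \/ nrm = @l2_norm R d ->
  measurable_fun setT (fun w => (sgn *: box_hamiltonian nrm alpha (omega^~ w) L) i j).
Proof.
move=> nrmE.
under eq_fun do rewrite mxE box_hamiltonianE//.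
apply: measurable_funM => //; apply: measurable_funD => //.
by apply: measurable_funM => //; apply: measurable_funM.
Qed.

End RandomSpectrum.

(** * Asymptotics of the diagonal maximum and of the top eigenvalue *)

Section BoxMaximum.
Variables (R : realType) (d : nat) (alpha delta : R) (nrm : lattice d -> R)
  (disp : measure_display) (Omega : measurableType disp)
  (P : probability Omega R) (omega : lattice d -> {RV P >-> R}) (sgn : R).
Hypotheses (d_gt0 : (0 < d)%N) (alpha_gt0 : 0 < alpha) (delta_gt0 : 0 < delta)
  (alphadelta_le : alpha * delta <= d%:R)
  (nrmE : nrm = @l1_norm R d \/ nrm = @l2_norm R d)
  (omega_indep : mutually_independent omega)
  (omega_law : forall n, has_density (omega n) (pareto_density delta))
  (sgnE : sgn = 1 \/ sgn = -1).
Implicit Types (n : lattice d) (L : nat) (T : R).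

Let s := alpha * delta.
Let G := Gamma d alpha delta.
Let S := normalized_weight_sum nrm alpha delta.
Let nrm1 n : 1 <= 1 + nrm n. Proof. by rewrite lerDl lattice_norm_ge0. Qed.
Let nrm1_gt0 n : 0 < 1 + nrm n. Proof. by rewrite (lt_le_trans ltr01). Qed.

Let one_powR (a : R) : 1 `^ a = 1. Proof. by rewrite powR1. Qed.

(** The event that the diagonal maximum is at most [T], with denominators cleared. *)
Let box L T : set Omega :=
  [set w | forall n, n \in fset_set (cube L) -> sgn * omega n w <= T * (1 + nrm n) `^ alpha].

(** For [T >= 1], the probability that the diagonal entry at [n] exceeds [T]. *)
Let z T n : R := T `^ (- delta) / 2 * (1 + nrm n) `^ (- s).

Let boxE L T : box L T = \bigcap_(n in [set` fset_set (cube L)])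
  omega n @^-1` [set x | sgn * x <= T * (1 + nrm n) `^ alpha].
Proof. by []. Qed.

Let measurable_half (c : R) : measurable [set x : R | sgn * x <= c].
Proof.
case: sgnE => ->.
  rewrite (_ : [set _ | _] = `]-oo, c]%classic)//.
  by apply/seteqP; split => x /=; rewrite in_itv/= mul1r.
rewrite (_ : [set _ | _] = `[- c, +oo[%classic)//.
by apply/seteqP; split => x /=; rewrite in_itv/= mulN1r lerNl andbT.
Qed.

Let measurable_box L T : measurable (box L T).
Proof.
rewrite boxE; apply: fin_bigcap_measurable; first exact: finite_fset.
by move=> n _; apply: measurable_funPTI; [exact: measurable_half].
Qed.

Let box_subset L T T' : T <= T' -> box L T `<=` box L T'.
Proof. by move=> TT w H n nL; rewrite (le_trans (H n nL))// ler_wpM2r// powR_ge0. Qed.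

Let P_box L T : 1 <= T -> P (box L T) = (\prod_(n <- fset_set (cube L)) (1 - z T n))%:E.
Proof.
move=> T1; rewrite boxE omega_indep// -prodEFin; apply: eq_bigr => n _.
have -> : omega n @^-1` [set x | sgn * x <= T * (1 + nrm n) `^ alpha] =
  [set w | sgn * omega n w <= T * (1 + nrm n) `^ alpha] by [].
have n1 : 1 <= (1 + nrm n) `^ alpha.
  by rewrite -[leLHS](one_powR alpha) ge0_ler_powR ?nnegrE ?(ltW alpha_gt0) ?(ltW (nrm1_gt0 n)).
have T0 : 0 <= T by rewrite (le_trans ler01).
rewrite (pareto_signed_cdf delta_gt0 (omega_law n) sgnE); last exact: mulr_ege1.
congr (1 - _)%:E; rewrite /z powRM ?powR_ge0// -powRrM mulrN mulrAC.
by congr (_ * _); rewrite /s; congr (_ `^ _).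
Qed.

Let P_box_bounds L T : 1 <= T ->
  ((expR (- (T `^ (- delta) / 2 * weight_sum nrm s L / (1 - T `^ (- delta) / 2))))%:E
    <= P (box L T) <= (expR (- (T `^ (- delta) / 2 * weight_sum nrm s L)))%:E)%E.
Proof.
move=> T1; set eta := T `^ (- delta) / 2; set Z := eta * _.
rewrite P_box// !lee_fin.
have eta1 : eta <= 1 / 2.
  by rewrite /eta ler_pM2r// -[leRHS](one_powR (- delta)) powRN_le// ltW.
have eta_lt1 : eta < 1 by lra.
have s0 : 0 <= s by rewrite /s mulr_ge0// ltW.
have zb n : 0 <= z T n /\ z T n <= eta.
  split; first by rewrite /z mulr_ge0 ?powR_ge0// divr_ge0 ?powR_ge0.
  rewrite /z -/eta ler_piMr ?divr_ge0 ?powR_ge0//.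
  by rewrite -[leRHS](one_powR (- s)) powRN_le.
have -> : Z = \sum_(n <- fset_set (cube L)) z T n by rewrite /Z /weight_sum mulr_sumr.
rewrite mulr_suml -!sumrN !expR_sum; apply/andP; split; apply: ler_prod => n _;
  have [z0 ze] := zb n; have /andP[H1 H2] := expRN_le_1B z0 ze eta_lt1.
  by rewrite expR_ge0 H1.
by rewrite H2 andbT subr_ge0 (le_trans ze)// ltW.
Qed.

Variable b : R.
Hypotheses (b_gt0 : 0 < b) (S_cvg : S L @[L --> \oo] --> b).

Let Gy : G L @[L --> \oo] --> +oo.
Proof. exact: Gamma_cvgy. Qed.

Let G_gt0 : \forall L \near \oo, 0 < G L.
Proof. by move/cvgryPgt : Gy; exact. Qed.

Let weight_sumE L : 0 < G L -> weight_sum nrm s L = G L `^ delta * S L.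
Proof.
move=> GL; rewrite /S normalized_weight_sumE// mulrA divff ?mul1r//.
by rewrite gt_eqF// powR_gt0.
Qed.

(** The shift [c] disappears because [G] tends to infinity: with [T = y G - c], the ratio [T / G]
    tends to [y], and [T^(-delta) W / 2 = (T / G)^(-delta) S / 2] tends to [b / (2 y^delta)]. As
    [eta] tends to 0, the two bounds of [P_box_bounds] have the same limit. *)
Let box_cvg_gt0 y c : 0 < y ->
  P (box L (y * G L - c)) @[L --> \oo] --> (expR (- (b / (2 * y `^ delta))))%:E.
Proof.
move=> y0; pose T L := y * G L - c.
have Ty : T L @[L --> \oo] --> +oo.
  apply/cvgryPge => A; near=> L.
  have : (A + c) / y <= G L by near: L; move/cvgryPge : Gy; exact.
  by rewrite ler_pdivrMr// /T mulrC; lra.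
have Vy : (G L)^-1 @[L --> \oo] --> 0 by apply/(gtr0_cvgV0 G_gt0).
have TG : T L / G L @[L --> \oo] --> y.
  rewrite -[X in _ --> X]subr0 -[X in _ - X](mulr0 c).
  apply: cvg_trans (cvgB (cvg_cst y) (cvgM (cvg_cst c) Vy)).
  apply: near_eq_cvg; near=> L.
  have GL : 0 < G L by near: L.
  by rewrite /T mulrBl mulfK// gt_eqF.
have TGd : (T L / G L) `^ (- delta) @[L --> \oo] --> y `^ (- delta).
  by apply: cvg_powR.
pose eta L := T L `^ (- delta) / 2.
have eta0 : eta L @[L --> \oo] --> 0.
  rewrite -[X in _ --> X](mul0r 2^-1); apply: cvgM; last exact: cvg_cst.
  exact: powRN_cvg0.
pose Z L := T L `^ (- delta) / 2 * weight_sum nrm s L.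
have Zb : Z L @[L --> \oo] --> b / (2 * y `^ delta).
  rewrite (_ : b / _ = y `^ (- delta) / 2 * b); last first.
    by rewrite powRN; field; rewrite gt_eqF// powR_gt0.
  have H : (T L / G L) `^ (- delta) / 2 * S L @[L --> \oo] --> y `^ (- delta) / 2 * b.
    by apply: cvgM => //; apply: cvgM => //; exact: cvg_cst.
  apply: cvg_trans H.
  apply: near_eq_cvg; near=> L.
  have GL : 0 < G L by near: L.
  have TL : 0 < T L by near: L; move/cvgryPgt : Ty; exact.
  rewrite /Z weight_sumE// powRM ?invr_ge0 ?(ltW TL) ?(ltW GL)//.
  rewrite -powR_inv1 ?(ltW GL)// -powRrM mulrNN mul1r.
  by ring.
have expc : forall u : nat -> R, forall l, u L @[L --> \oo] --> l ->
    (expR (- u L))%:E @[L --> \oo] --> (expR (- l))%:E.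
  move=> u l ul; apply: cvg_EFin; first exact: nearW.
  exact: (continuous_cvg _ (@continuous_expR R (- l)) (cvgN ul)).
apply: (@squeeze_cvge _ _ _ _ (fun L => (expR (- (Z L / (1 - eta L))))%:E) _
    (fun L => (expR (- Z L))%:E)).
- near=> L; apply: P_box_bounds.
  by near: L; move/cvgryPge : Ty; exact.
- apply: expc; rewrite -[X in _ --> X]mulr1 -[X in _ * X]invr1; apply: cvgM => //.
  apply: cvgV => //; rewrite -[X in _ --> X]subr0.
  by apply: cvgB => //; exact: cvg_cst.
- exact: expc.
Unshelve. all: by end_near. Qed.

(** At the fixed level 1 the upper bound is [exp (- W / 2)], and [W = G^delta S] tends to infinity.
    Levels [y G - c <= 0] follow by monotonicity of [box], the product formula being available only
    from level 1 on. *)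
Let box_cvg0 : P (box L 1) @[L --> \oo] --> 0%E.
Proof.
have b2 : b / 2 < b by rewrite ltr_pdivrMr// ltr_pMr// ltr1n.
have Sb : \forall L \near \oo, b / 2 <= S L by exact: (cvgr_ge b S_cvg _ b2).
have Wy : weight_sum nrm s L / 2 @[L --> \oo] --> +oo.
  apply/cvgryPge => A; near=> L; have GL : 0 < G L by near: L.
  have bS : b / 2 <= S L by near: L; exact: Sb.
  have AG : A / (b / 4) <= G L `^ delta.
    by near: L; have /cvgryPge := Gamma_powR_cvgy d alpha delta_gt0; exact.
  rewrite weight_sumE//; move: AG; rewrite ler_pdivrMr ?divr_gt0// => /le_trans; apply.
  by rewrite -mulrA ler_pM2l ?powR_gt0//; lra.
apply: (@squeeze_cvge _ _ _ _ (fun=> 0%E) _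
    (fun L => (expR (- (weight_sum nrm s L / 2)))%:E)).
- near=> L; rewrite measure_ge0/=.
  by have /andP[_] := @P_box_bounds L 1 (lexx _); rewrite powR1 mul1r mulrC.
- exact: cvg_cst.
- apply: cvg_EFin; first exact: nearW.
  exact: (cvg_comp _ _ Wy (@cvgr_expR R)).
Unshelve. all: by end_near. Qed.

Let box_cvg_le0 y c : y <= 0 -> 0 <= c -> P (box L (y * G L - c)) @[L --> \oo] --> 0%E.
Proof.
move=> y0 c0; apply: (@squeeze_cvge _ _ _ _ (fun=> 0%E) _ (fun L => P (box L 1))) => //.
- near=> L; rewrite measure_ge0/=.
  have GL : 0 < G L by near: L.
  apply: le_measure; rewrite ?inE; [exact: measurable_box..|].
  apply: box_subset; have : y * G L <= 0 by rewrite mulr_le0_ge0// ltW.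
  by lra.
- exact: cvg_cst.
Unshelve. all: by end_near. Qed.

Let F y : \bar R := (if 0 < y then expR (- (b / (2 * y `^ delta))) else 0)%:E.

Let box_cvg y c : 0 <= c -> P (box L (y * G L - c)) @[L --> \oo] --> F y.
Proof.
move=> c0; rewrite /F; case: ltP => y0; first exact: box_cvg_gt0.
exact: box_cvg_le0.
Qed.

Let K L w := sgn *: box_hamiltonian nrm alpha (fun n => omega n w) L.

Let measurable_max_spectrum_le L T : measurable [set w | max_spectrum (K L w) <= T].
Proof.
apply: (random_max_spectrum_le_measurable (box_size_gt0 d L)) => [w|i j].
  by rewrite linearZ /= box_hamiltonian_sym.
exact: measurable_signed_hamiltonian.
Qed.

Let measurable_max_spectrum_lt L T : measurable [set w | max_spectrum (K L w) < T].
Proof.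
apply: (random_max_spectrum_lt_measurable (box_size_gt0 d L)) => [w|i j].
  by rewrite linearZ /= box_hamiltonian_sym.
exact: measurable_signed_hamiltonian.
Qed.

(** The events [box (x G - c)], [max < x G], [max <= x G] and [box (x G)] increase in this order,
    and the outer two have the same limiting probability. The strict version is the one that yields
    the lowest eigenvalue. *)
Lemma max_spectrum_cdf_cvg x :
  P [set w | max_spectrum (K L w) / G L <= x] @[L --> \oo] --> F x /\
  P [set w | max_spectrum (K L w) / G L < x] @[L --> \oo] --> F x.
Proof.
(* The Gershgorin constant, plus 1 to make the inequality strict. *)
pose c : R := #|` fset_set (@cube d 1)|%:R + 1.
have c0 : 0 <= c by rewrite addr_ge0.
have leE : \forall L \near \oo, [set w | max_spectrum (K L w) / G L <= x] =
    [set w | max_spectrum (K L w) <= x * G L].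
  near=> L; have GL : 0 < G L by near: L.
  by apply/seteqP; split=> w /=; rewrite ler_pdivrMr.
have ltE : \forall L \near \oo, [set w | max_spectrum (K L w) / G L < x] =
    [set w | max_spectrum (K L w) < x * G L].
  near=> L; have GL : 0 < G L by near: L.
  by apply/seteqP; split=> w /=; rewrite ltr_pdivrMr.
have lo L : (P (box L (x * G L - c)) <= P [set w | (max_spectrum (K L w) < x * G L)%R])%E.
  apply: le_measure; rewrite ?inE; [exact: measurable_box|exact: measurable_max_spectrum_lt|].
  move=> w /= /(max_spectrum_box_le nrmE sgnE)/le_lt_trans; apply.
  by rewrite /c; lra.
have mi L : (P [set w | (max_spectrum (K L w) < x * G L)%R] <=
    P [set w | (max_spectrum (K L w) <= x * G L)%R])%E.
  apply: le_measure; rewrite ?inE; [exact: measurable_max_spectrum_lt|exact: measurable_max_spectrum_le|].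
  by move=> w /= /ltW.
have hi L : (P [set w | (max_spectrum (K L w) <= x * G L)%R] <= P (box L (x * G L - 0)))%E.
  apply: le_measure; rewrite ?inE; [exact: measurable_max_spectrum_le|exact: measurable_box|].
  by move=> w /= H; rewrite subr0; exact: max_spectrum_box_ge H.
have lc := box_cvg (y := x) c0; have hc := box_cvg (y := x) (lexx 0).
split; apply: (@squeeze_cvge _ _ _ _ (fun L => P (box L (x * G L - c))) _
    (fun L => P (box L (x * G L - 0)))) => //; near=> L.
  rewrite (near leE L)//; apply/andP; split; last exact: hi.
  exact: le_trans (mi L).
rewrite (near ltE L)//; apply/andP; split; first exact: lo.
exact: le_trans (hi L).
Unshelve. all: by end_near. Qed.

End BoxMaximum.

Theorem theorem1p5 (R : realType) (d : nat) (alpha delta : R)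
    (nrm : lattice d -> R)
    (disp : measure_display) (Omega : measurableType disp)
    (P : probability Omega R) (omega : lattice d -> {RV P >-> R})
    (d_ge1 : (1 <= d)%N) (alpha_gt0 : 0 < alpha) (delta_gt0 : 0 < delta)
    (alphadelta_le : alpha * delta <= d%:R)
    (nrmE : nrm = @l1_norm R d \/ nrm = @l2_norm R d)
    (omega_indep : mutually_independent omega)
    (omega_law : forall n, has_density (omega n) (pareto_density delta)) :
  let H w L := box_hamiltonian nrm alpha (fun n => omega n w) L in
  let Emax L w := max_spectrum (H w L) in
  let Emin L w := min_spectrum (H w L) in
  let G L := Gamma d alpha delta L in
  exists b : R,
    [/\ 0 < b,
        normalized_weight_sum nrm alpha delta L @[L --> \oo] --> b,
        forall x : R,
          P [set w | Emax L w / G L <= x] @[L --> \oo] -->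
          (if 0 < x then expR (- (b / (2 * x `^ delta))) else 0)%:E
      & forall x : R,
          P [set w | Emin L w / G L <= x] @[L --> \oo] -->
          (if 0 <= x then 1 else 1 - expR (- (b / (2 * `|x| `^ delta))))%:E].
Proof.
move=> H Emax Emin G.
have [b b0 Sb] := normalized_weight_sum_cvg nrmE d_ge1 alpha_gt0 delta_gt0 alphadelta_le.
exists b; split=> // x.
  have [Hx _] := max_spectrum_cdf_cvg alpha_gt0 delta_gt0 nrmE omega_indep
    omega_law (or_introl (erefl : 1 = 1)) b0 Sb x.
  apply: cvg_trans Hx; apply: near_eq_cvg; apply: nearW => L.
  by under eq_set do rewrite scale1r.
have [_ Hx] := max_spectrum_cdf_cvg alpha_gt0 delta_gt0 nrmE omega_indep
    omega_law (or_intror (erefl : -1 = -1)) b0 Sb (- x).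
have EN L w : Emin L w = - max_spectrum (-1 *: H w L) by rewrite scaleN1r -min_spectrumN.
(* [Emin / G <= x] fails exactly when the top eigenvalue of [-H], divided by [G], is below [-x];
   hence the strict distribution function at [-x]. *)
have E : \forall L \near \oo, P [set w | Emin L w / G L <= x] =
    (1 - P [set w | (max_spectrum (-1 *: H w L) / G L < - x)%R])%E.
  near=> L; have GL : 0 < G L.
    by near: L; have /cvgryPgt := Gamma_cvgy d alpha delta_gt0; exact.
  rewrite -probability_setC.
    by congr (P _); apply/seteqP; split => w /=; rewrite EN mulNr lerNl leNgt => /negP.
  under eq_set do rewrite ltr_pdivrMr//.
  apply: (random_max_spectrum_lt_measurable (box_size_gt0 d L)) => [w|i j].
    by rewrite linearZ /= box_hamiltonian_sym.
  exact: measurable_signed_hamiltonian.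
rewrite (_ : EFin _ = (1 - (if 0 < - x then expR (- (b / (2 * (- x) `^ delta))) else 0)%:E)%E).
  have H1 : (1 - P [set w | (max_spectrum (-1 *: H w L) / G L < - x)%R])%E @[L --> \oo] -->
      (1 - (if 0 < - x then expR (- (b / (2 * (- x) `^ delta))) else 0)%:E)%E.
    by apply: cvgeB => //; exact: cvg_cst.
  apply: cvg_trans H1; apply: near_eq_cvg; near=> L.
  by rewrite (near E L).
rewrite -EFinB oppr_gt0; case: leP => x0; first by rewrite subr0.
by rewrite ltr0_norm.
Unshelve. all: by end_near. Qed.
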